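(* Let $X$ be an uncountable compact metric space and let $n$ be a positive integer. Let $\dim$ denote any one of $\dim_{\mathrm T}$, $\dim_{\mathrm H}$ or $\underline{\dim}_{\mathrm B}$. Then $C_n(X)$ is the disjoint union of the three sets \[ A = \{ f \in C_n(X) : 0 \leq \dim f(X) < \min\{n, \dim_{\mathrm T} X\} \}, \] \[ B = \{ f \in C_n(X) : \dim f(X) = \min\{n, \dim_{\mathrm T} X\} \}, \] \[ C = \{ f \in C_n(X) : \min\{n, \dim_{\mathrm T} X\} < \dim f(X) \leq n \}, \] where $A$ is nowhere dense in $C_n(X)$; $B$ is residual in $C_n(X)$; and $C$ is meagre but dense in $C_n(X)$, unless $n \leq \dim_{\mathrm T} X$, in which case $C$ is empty.
   Context: $C_n(X)$ is the Banach space of all continuous functions $f\colon X\to\mathbb{R}^n$ with the supremum norm $\|\cdot\|_\infty$. In a complete metric space, a set is meagre if it is a countable union of nowhere dense sets, and residual if its complement is meagre. $\dim_{\mathrm T}$ denotes topological (small inductive, equivalently Lebesgue covering) dimension, a non-negative integer or $+\infty$ for non-empty spaces. $\dim_{\mathrm H}$ denotes Hausdorff dimension. For a non-empty bounded $F\subseteq\mathbb{R}^n$, let $N_\delta(F)$ be the smallest number of open sets of diameter at most $\delta$ needed to cover $F$; then $\underline{\dim}_{\mathrm B} F=\liminf_{\delta\to0}\log N_\delta(F)/(-\log\delta)$. *)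

(* Defs.v *)
From HB Require Import structures.
From mathcomp Require Import all_boot all_order all_algebra.
From mathcomp Require Import ring lra.
From mathcomp Require Import all_classical all_reals all_analysis.

Set Implicit Arguments.
Unset Strict Implicit.
Unset Printing Implicit Defensive.

Import Order.TTheory GRing.Theory Num.Theory.
Import numFieldNormedType.Exports.

Local Open Scope classical_set_scope.
Local Open Scope ring_scope.

Section baire_category.
Context {T : topologicalType}.

Definition nowhere_dense (A : set T) : Prop := interior (closure A) = set0.

Definition meagre (A : set T) : Prop :=
  exists F : (set T)^nat, (forall i, nowhere_dense (F i)) /\ A = \bigcup_i F i.

Definition residual (A : set T) : Prop := meagre (~` A).

End baire_category.

Section euclidean_norm.
Context {R : realType} {n : nat}.
Implicit Types v w : 'rV[R]_n.

(* The norm of the library on 'rV[R]_n is the maximum norm; it induces the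
   same topology, but diameters are measured with the Euclidean norm. *)
Definition enorm v : R := Num.sqrt (\sum_i v ord0 i ^+ 2).

Lemma enorm_ge0 v : 0 <= enorm v. Proof. exact: sqrtr_ge0. Qed.

Lemma sqr_enorm v : enorm v ^+ 2 = \sum_i v ord0 i ^+ 2.
Proof. by rewrite sqr_sqrtr// sumr_ge0// => i _; exact: sqr_ge0. Qed.

Lemma enorm_eq0 v : enorm v = 0 -> v = 0.
Proof.
move=> v0; have := sqr_enorm v; rewrite v0 expr0n/= => /esym/eqP.
rewrite psumr_eq0; last by move=> i _; exact: sqr_ge0.
move=> /allP s0; apply/rowP => i; rewrite mxE; apply/eqP.
by have := s0 i (mem_index_enum i); rewrite /= sqrf_eq0.
Qed.

Lemma enormZ (a : R) v : enorm (a *: v) = `|a| * enorm v.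
Proof.
rewrite /enorm -sqrtr_sqr -sqrtrM ?sqr_ge0// mulr_sumr; congr Num.sqrt.
by apply: eq_bigr => i _; rewrite mxE exprMn.
Qed.

Lemma enorm_dot v w :
  \sum_i v ord0 i * w ord0 i <= enorm v * enorm w.
Proof.
have [v0|v0] := eqVneq (enorm v) 0.
  by rewrite v0 mul0r (enorm_eq0 v0) big1// => i _; rewrite mxE mul0r.
have [w0|w0] := eqVneq (enorm w) 0.
  by rewrite w0 mulr0 (enorm_eq0 w0) big1// => i _; rewrite mxE mulr0.
have a0 : 0 < enorm v by rewrite lt0r v0 enorm_ge0.
have b0 : 0 < enorm w by rewrite lt0r w0 enorm_ge0.
have ab0 : 0 < 2 * (enorm v * enorm w) by rewrite !mulr_gt0.
rewrite -(ler_pM2l ab0).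
have : 0 <= \sum_i (enorm w * v ord0 i - enorm v * w ord0 i) ^+ 2.
  by apply: sumr_ge0 => i _; exact: sqr_ge0.
rewrite (eq_bigr (fun i => (enorm w ^+ 2 * v ord0 i ^+ 2 +
    enorm v ^+ 2 * w ord0 i ^+ 2) -
    2 * (enorm v * enorm w) * (v ord0 i * w ord0 i))); last first.
  by move=> i _; ring.
rewrite sumrB big_split/= -!mulr_sumr -!sqr_enorm subr_ge0 => /le_trans; apply.
by rewrite le_eqVlt; apply/orP; left; apply/eqP; ring.
Qed.

Lemma ler_enormD v w : enorm (v + w) <= enorm v + enorm w.
Proof.
rewrite -(@ler_pXn2r _ 2)// ?nnegrE ?addr_ge0 ?enorm_ge0//.
rewrite sqr_enorm.
rewrite (eq_bigr (fun i => (v ord0 i ^+ 2 + w ord0 i ^+ 2) +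
    2 * (v ord0 i * w ord0 i))); last by move=> i _; rewrite mxE; ring.
rewrite 2!big_split/= -mulr_sumr -!sqr_enorm sqrrD -mulr_natl.
have := enorm_dot v w; lra.
Qed.

Lemma enorm_le_norm v : enorm v <= Num.sqrt n%:R * `|v|.
Proof.
rewrite -[X in _ * X]ger0_norm// -sqrtr_sqr -sqrtrM// ler_wsqrtr//.
have -> : n%:R * `|v| ^+ 2 = \sum_(i < n) `|v| ^+ 2.
  by rewrite sumr_const card_ord mulr_natl.
apply: ler_sum => i _; rewrite -real_normK ?num_real// ler_pXn2r ?nnegrE//.
rewrite [leRHS]/Num.norm/= mx_normrE.
exact: (le_bigmax _ (fun ij => `|v ij.1 ij.2|) (ord0, i)).
Qed.

End euclidean_norm.

Section continuous_maps.
Context {R : realType} {X : metricType R} {n : nat}.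

Definition continuous_map : {pred X -> 'rV[R]_n} := [pred f | `[< continuous f >]].

Lemma continuous_map_submod : submod_closed continuous_map.
Proof.
split=> [|a f g /asboolP cf /asboolP cg]; apply/asboolP.
  by move=> x; exact: cvg_cst.
move=> x; apply: cvgD; last exact: cg.
by apply: cvgZr; exact: cf.
Qed.

HB.instance Definition _ :=
  GRing.isSubmodClosed.Build R (X -> 'rV[R]_n) continuous_map
    continuous_map_submod.

End continuous_maps.

(* The compactness proof is a parameter of the type because it is what makes
   the supremum in [supnorm] finite, hence [supnorm] a norm. *)
Record Cn (R : realType) (X : metricType R) (cptX : compact [set: X])
    (n : nat) := MkCn {
  Cn_fun :> X -> 'rV[R]_n ;
  Cn_continuous : Cn_fun \in continuous_map }.

Section Cn_normedModType.
Context {R : realType} (X : metricType R) (cptX : compact [set: X]) (n : nat).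

HB.instance Definition _ := [isSub for @Cn_fun R X cptX n].
HB.instance Definition _ := [Choice of Cn cptX n by <:].
HB.instance Definition _ := [SubChoice_isSubLmodule of Cn cptX n by <:].

Definition supnorm (f : Cn cptX n) : R := sup [set enorm (f x) | x in [set: X]].

Lemma supnorm_has_ubound (f : Cn cptX n) :
  has_ubound [set enorm (f x) | x in [set: X]].
Proof.
have cf : compact (f @` [set: X]).
  apply: continuous_compact => //; apply: continuous_subspaceT.
  by have /asboolP := Cn_continuous f.
have [M [_ fM]] := compact_bounded cf.
exists (Num.sqrt n%:R * (M + 1)) => _ [x _ <-].
rewrite (le_trans (enorm_le_norm _))// ler_wpM2l ?sqrtr_ge0//.
by apply: fM; [rewrite ltrDl|exists x].
Qed.

Lemma enorm_le_supnorm (f : Cn cptX n) x : enorm (f x) <= supnorm f.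
Proof. by apply: ub_le_sup; [exact: supnorm_has_ubound|exists x]. Qed.

Lemma supnorm_le (f : Cn cptX n) (M : R) : 0 <= M ->
  (forall x, enorm (f x) <= M) -> supnorm f <= M.
Proof.
move=> M0 fM; have [[x]|E] := pselect ([set: X] !=set0).
  move=> _; apply: ge_sup; first by exists (enorm (f x)), x.
  by move=> _ [y _ <-].
rewrite /supnorm [X in sup X](_ : _ = set0) ?sup0//.
by apply/eqP/negPn/negP => /set0P[_ [x _ _]]; apply: E; exists x.
Qed.

Lemma supnorm_ge0 (f : Cn cptX n) : 0 <= supnorm f.
Proof.
have [[x _]|E] := pselect ([set: X] !=set0).
  exact: le_trans (enorm_ge0 _) (enorm_le_supnorm f x).
rewrite /supnorm [X in sup X](_ : _ = set0) ?sup0//.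
by apply/eqP/negPn/negP => /set0P[_ [x _ _]]; apply: E; exists x.
Qed.

Lemma ler_supnormD (f g : Cn cptX n) :
  supnorm (f + g) <= supnorm f + supnorm g.
Proof.
apply: supnorm_le => [|x]; first by rewrite addr_ge0// supnorm_ge0.
by rewrite (le_trans (ler_enormD _ _))// lerD// enorm_le_supnorm.
Qed.

Lemma supnormZ (a : R) (f : Cn cptX n) : supnorm (a *: f) = `|a| * supnorm f.
Proof.
have le b h : supnorm (b *: h) <= `|b| * supnorm h.
  apply: supnorm_le => [|x]; first by rewrite mulr_ge0// supnorm_ge0.
  by rewrite enormZ ler_wpM2l// enorm_le_supnorm.
apply/eqP; rewrite eq_le le/=.
have [->|a0] := eqVneq a 0; first by rewrite normr0 mul0r supnorm_ge0.
rewrite -[f in leLHS](@scalerK _ _ _ a0) -ler_pdivlMl ?normr_gt0// -normfV.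
exact: le.
Qed.

Lemma supnorm_eq0 (f : Cn cptX n) : supnorm f = 0 -> f = 0.
Proof.
move=> f0; apply/val_inj/funext => x; apply: enorm_eq0.
by apply/eqP; rewrite eq_le enorm_ge0 -f0 enorm_le_supnorm.
Qed.

HB.instance Definition _ := Lmodule_isNormed.Build R (Cn cptX n)
  ler_supnormD supnormZ supnorm_eq0.

End Cn_normedModType.

Section topological_dimension.
Context {R : realType}.
Local Open Scope ereal_scope.

Definition covering_dim_le (T : topologicalType) (k : nat) : Prop :=
  forall (m : nat) (U : 'I_m -> set T),
    (forall i, open (U i)) -> \bigcup_i U i = setT ->
  exists (p : nat) (V : 'I_p -> set T),
    [/\ forall j, open (V j),
        \bigcup_j V j = setT,
        forall j, exists i, V j `<=` U i &
        forall J : {set 'I_p}, #|J| = k.+2 ->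
          \bigcap_(j in [set` J]) V j = set0].

(* Lebesgue covering dimension of a non-empty space (for the empty space the
   value is 0 instead of the usual -1). *)
Definition topological_dim (T : topologicalType) : \bar R :=
  ereal_inf [set k%:R%:E | k in [set k | covering_dim_le T k]].

End topological_dimension.

Section metric_dimensions.
Context {R : realType} {n : nat}.
Local Open Scope ereal_scope.
Implicit Types (F U : set 'rV[R]_n) (d s : R).

Definition dimT F : \bar R := topological_dim (set_type F).

(* The 0 adjoined to the set makes the diameter of the empty set 0. *)
Definition diam U : \bar R :=
  ereal_sup (0 |` [set (enorm (x - y)%R)%:E | x in U & y in U]).

(* The empty set is singled out because 0 `^ 0 = 1. *)
Definition hausdorff_gauge s U : \bar R :=
  if U == set0 then 0 else diam U `^ s.

Definition hausdorff_premeasure s d F : \bar R :=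
  ereal_inf [set \sum_(i <oo) hausdorff_gauge s (U i) |
    U in [set U : (set 'rV[R]_n)^nat |
      (forall i, diam (U i) <= d%:E) /\ F `<=` \bigcup_i U i]].

Definition hausdorff_measure s F : \bar R :=
  ereal_sup [set hausdorff_premeasure s d F | d in [set d | (0 < d)%R]].

Definition dimH F : \bar R :=
  ereal_inf [set s%:E | s in [set s | (0 <= s)%R /\ hausdorff_measure s F = 0]].

Definition covered_by F d (k : nat) : Prop :=
  exists U : 'I_k -> set 'rV[R]_n,
    (forall i, open (U i) /\ diam (U i) <= d%:E) /\ F `<=` \bigcup_i U i.

Definition covering_number F d : \bar R :=
  ereal_inf [set k%:R%:E | k in [set k | covered_by F d k]].

Definition lower_dimB F : \bar R :=
  limf_einf (fun d => lne (covering_number F d) / (- ln d)%:E) 0^'+.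

End metric_dimensions.

(* Main.v *)
Require Import Defs.
From mathcomp Require Import all_boot all_order all_algebra.
From mathcomp Require Import ring lra zify.
From mathcomp Require Import all_classical all_reals all_analysis.

(* Every f satisfies 0 <= dim_T f(X) <= dim_H f(X) <= dim_B f(X) <= n, so the
   lower bounds need only be proved for dim_T and the upper bounds for the
   lower box dimension.  A compact K has covering dimension at most k iff no
   map of K to the cube [-1, 1]^(k+1) is essential.

   A: if dim_T X > k, some small piece of X on which f is almost constant has
   an essential map to [-1, 1]^(k+1); a small copy of it is planted in f, and
   essentiality survives perturbation, so all maps near the new one have an
   image of dimension greater than k.

   B: if dim_T X = k, the partition of unity of a fine cover of order k + 1
   moves f slightly to a map into finitely many k-simplices.  Hence, for
   arbitrarily small d, few sets of diameter d cover the image, which is an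
   open condition on the map.

   C: X contains a Cantor set on which f is almost constant; mapping it onto a
   small n-cube gives an image of dimension n, because the identity of the
   cube is essential (Poincare-Miranda).

   The essential maps also give dim_T <= dim_H: a Lipschitz map of a set of
   Hausdorff measure H^(k+1) zero misses a point of the (k+1)-cube. *)

Import Order.TTheory GRing.Theory Num.Theory.
Import numFieldNormedType.Exports.

Local Open Scope classical_set_scope.
Local Open Scope ring_scope.

Set Implicit Arguments.
Unset Strict Implicit.
Unset Printing Implicit Defensive.

(** Having an image of dimension at most k is not a closed condition: a limit of maps with finite
    images can be onto a cube. An essential map gives a margin instead. Its prescribed values 1 and
    -1 on opposite faces are a definite distance apart, so a map h within e/2 of a planted copy of
    size e still separates the faces after rescaling, and a deformation of h(X) away from the centre
    would pull back to one of the planted map. The finite sum theorem for closed sets finds the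
    piece of X that carries the essential map, and planting it uses k+1 of the n coordinates, whence
    the minimum of n and dim_T X.

    For B the margin comes from compactness: the covers are open, so they absorb small moves of the
    image. Because the box dimension is a lower limit, one economical scale per bound is enough, and
    the maps that fail form countably many nowhere dense sets. The same sets make C meagre. If n <=
    dim_T X, the complement of B is A alone. *)

Section continuous_pointwise.
Context {R : realType} {T : topologicalType} (f g : T -> R).
Hypotheses (cf : continuous f) (cg : continuous g).

Lemma continuous_addr : continuous (fun x => f x + g x).
Proof. by move=> x; apply: (@cvgD _ R^o); [exact: cf|exact: cg]. Qed.

Lemma continuous_subr : continuous (fun x => f x - g x).
Proof. by move=> x; apply: (@cvgB _ R^o); [exact: cf|exact: cg]. Qed.

Lemma continuous_mulr : continuous (fun x => f x * g x).
Proof. by move=> x; apply: cvgM; [exact: cf|exact: cg]. Qed.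

Lemma continuous_normr : continuous (fun x => `|f x|).
Proof. by move=> x; apply: (@cvg_norm _ R^o); exact: cf. Qed.

Lemma continuous_maxr : continuous (fun x => Num.max (f x) (g x)).
Proof. by move=> x; apply: continuous_max; [exact: cf|exact: cg]. Qed.

Lemma continuous_minr : continuous (fun x => Num.min (f x) (g x)).
Proof. by move=> x; apply: continuous_min; [exact: cf|exact: cg]. Qed.

End continuous_pointwise.

Lemma continuous_sumr (T : topologicalType) (R : realType)
    (V : normedModType R) (I : finType) (f : I -> T -> V) :
  (forall i, continuous (f i)) -> continuous (fun x => \sum_i f i x).
Proof.
by move=> cf x; apply: cvg_big => [|i _]; [exact: add_continuous|exact: cf].
Qed.

Lemma continuous_bigmaxr (T : topologicalType) (R : realType) (I : finType)
    (P : pred I) (f : I -> T -> R) :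
  (forall i, continuous (f i)) ->
  continuous (fun x => \big[Num.max/0]_(i | P i) f i x).
Proof.
move=> cf x; apply: cvg_big => [|i _]; last exact: cf.
by apply: continuous_maxr => z; [exact: cvg_fst|exact: cvg_snd].
Qed.

(** * Bump functions and Lebesgue numbers *)

Section bump.
Context {R : realType} {T : pseudoMetricType R}.
Implicit Types (U K : set T) (x y : T).

(* A substitute for the distance to the complement of U, defined from balls
   because 'rV[R]_n is only a pseudometric space in the library. *)
Definition bump U x : R :=
  sup [set r | r = 0 \/ 0 < r <= 1 /\ ball x r `<=` U].

Lemma bump_has_sup U x :
  has_sup [set r : R | r = 0 \/ 0 < r <= 1 /\ ball x r `<=` U].
Proof. by split; [exists 0; left | exists 1 => r [->//|[/andP[]]]]. Qed.

Lemma bump_ge0 U x : 0 <= bump U x.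
Proof. by apply: ub_le_sup; [case: (bump_has_sup U x)|left]. Qed.

Lemma bump_ge U x r : 0 < r <= 1 -> ball x r `<=` U -> r <= bump U x.
Proof. by move=> r01 rU; apply: ub_le_sup; [case: (bump_has_sup U x)|right]. Qed.

Lemma lt_bump_ball U x r : 0 <= r -> r < bump U x -> ball x r `<=` U.
Proof.
move=> r0 rU.
have e0 : 0 < bump U x - r by rewrite subr_gt0.
have [s [->|[_ sU]]] := sup_adherent e0 (bump_has_sup U x).
  by rewrite -/(bump U x) => ?; exfalso; lra.
rewrite -/(bump U x) => rs; apply: subset_trans sU; apply: le_ball; lra.
Qed.

Lemma bump_gt0_in U x : 0 < bump U x -> U x.
Proof.
move=> U0; have [s [->|[s1 sU]]] := sup_adherent U0 (bump_has_sup U x).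
  by rewrite -/(bump U x) => ?; exfalso; lra.
by move=> _; apply/sU/ballxx; case/andP: s1.
Qed.

Lemma bump_out U x : ~ U x -> bump U x = 0.
Proof.
move=> nU; apply/eqP; rewrite eq_le bump_ge0 andbT leNgt; apply/negP.
by move/bump_gt0_in.
Qed.

Lemma bump_gt0 U x : open U -> U x -> 0 < bump U x.
Proof.
rewrite openE => /[apply]; rewrite /interior nbhs_ballP => -[r /= r0 rU].
apply: (@lt_le_trans _ _ (Num.min r 1)); first by rewrite lt_min r0/=.
apply: bump_ge; first by rewrite lt_min r0 ge_min lexx orbT ltr01.
by apply: subset_trans rU; apply: le_ball; rewrite ge_min lexx.
Qed.

Lemma bump_ball U x y e : 0 < e -> ball x e y -> bump U x <= bump U y + e.
Proof.
move=> e0 xy; apply: ge_sup; first by exists 0; left.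
move=> r [->|[/andP[r0 r1] rU]]; first by rewrite addr_ge0 ?bump_ge0// ltW.
have [re|er] := leP r e; first by rewrite (le_trans re)// lerDr bump_ge0.
rewrite -lerBlDr; apply: bump_ge; first by apply/andP; split; lra.
move=> z yz; apply: rU; have := ball_triangle xy yz.
by rewrite [e + _]addrC subrK.
Qed.

Lemma bump_ball_norm U x y e : 0 < e -> ball x e y ->
  `|bump U x - bump U y| <= e.
Proof.
move=> e0 xy; rewrite ler_norml.
have := bump_ball U e0 xy; have := bump_ball U e0 (ball_sym xy).
by move=> ? ?; apply/andP; split; lra.
Qed.

Lemma bump_continuous U : continuous (bump U).
Proof.
move=> x; apply/cvgrPdist_le => e e0; apply/nbhs_ballP; exists e => //= y.
exact: bump_ball_norm.
Qed.

Lemma compact_gt0_bounded K (f : T -> R) : compact K -> continuous f ->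
  (forall x, K x -> 0 < f x) -> exists2 c, 0 < c & forall x, K x -> c <= f x.
Proof.
move=> cK cf f0; have [->|/set0P K0] := eqVneq K set0; first by exists 1.
have [|x Kx xK] := compact_EVT_min K0 cK (f := f).
  exact: continuous_subspaceT.
exists (f x) => [|y Ky]; first by apply: f0; rewrite inE in Kx.
by apply: xK; rewrite inE.
Qed.

(** The sum of the bumps is positive on K, hence bounded below, and one summand must be large. By
    [lt_bump_ball], balls of radius less than c about points of K then lie in a single [U i]. *)
Lemma Lebesgue_number (I : finType) (U : I -> set T) K : compact K ->
  (forall i, open (U i)) -> (forall x, K x -> exists i, U i x) ->
  exists2 c, 0 < c & forall x, K x -> exists i, c <= bump (U i) x.
Proof.
move=> cK oU KU.
have [| |c c0 cf] := @compact_gt0_bounded K (fun x => \sum_i bump (U i) x) cK.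
- by apply: continuous_sumr => i; exact: bump_continuous.
- move=> x /KU[i Uix]; rewrite (bigD1 i)//= ltr_wpDr ?bump_gt0//.
  by apply: sumr_ge0 => j _; exact: bump_ge0.
(* The successor keeps the divisor positive and makes the last comparison strict. *)
exists (c / (#|I|.+1)%:R) => [|x Kx]; first by rewrite divr_gt0.
apply: contrapT => /forallNP H; have := cf _ Kx; apply/negP; rewrite -ltNge.
apply: (@le_lt_trans _ _ (\sum_(i : I) c / (#|I|.+1)%:R)).
  by apply: ler_sum => i _; have /negP := H i; rewrite -ltNge => /ltW.
by rewrite sumr_const -[ltLHS]mulr_natl mulrCA gtr_pMr// ltr_pdivrMr// mul1r ltr_nat.
Qed.

End bump.

(** * Covering dimension and essential maps *)

Lemma open_forall (T : topologicalType) (I : finType) (P : I -> set T) :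
  (forall i, open (P i)) -> open [set x | forall i, P i x].
Proof.
move=> oP; rewrite openE => x Px; apply: filter_forall => i.
by apply: open_nbhs_nbhs; split.
Qed.

Lemma open_lt_fun (T : topologicalType) (R : realType) (f g : T -> R) :
  continuous f -> continuous g -> open [set x | f x < g x].
Proof.
move=> cf cg; have -> : [set x | f x < g x] = (g \- f) @^-1` [set y | 0 < y].
  by apply/seteqP; split => x /=; rewrite subr_gt0.
apply: open_comp => [x _|]; last exact: open_gt.
by apply: cvgB; [exact: cg|exact: cf].
Qed.

Lemma closed_le_fun (T : topologicalType) (R : realType) (f g : T -> R) :
  continuous f -> continuous g -> closed [set x | f x <= g x].
Proof.
move=> cf cg; have -> : [set x | f x <= g x] = ~` [set x | g x < f x].
  by apply/seteqP; split => x /=; rewrite leNgt => /negP.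
by apply: open_closedC; exact: open_lt_fun.
Qed.

(* Covering dimension of the subspace K, in terms of open sets of T and of
   indexed shrinkings instead of refinements. *)
Definition cdim_le (T : topologicalType) (K : set T) (k : nat) : Prop :=
  forall (I : finType) (U : I -> set T), (forall i, open (U i)) ->
    (forall x, K x -> exists i, U i x) ->
  exists V : I -> set T, [/\ forall i, open (V i), forall i, V i `<=` U i,
    forall x, K x -> exists i, V i x &
    forall x (J : {set I}), K x -> (forall j, j \in J -> V j x) ->
      (#|J| <= k.+1)%N].

Section cdim_le.
Context {T : topologicalType}.
Implicit Types (K L : set T) (k : nat).

Lemma cdim_leW K j k : (j <= k)%N -> cdim_le K j -> cdim_le K k.
Proof.
move=> jk Kj I U oU KU; have [V [oV VU KV H]] := Kj I U oU KU.
exists V; split => // x J Kx JV; exact: leq_trans (H _ _ Kx JV) _.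
Qed.

(** The cover is shrunk for K only, keeping each set unchanged off K, which is open because K is
    closed. The same step for L starts from the result, and shrinking further cannot raise the order
    on K. *)
Lemma cdim_leU K L k : closed K -> closed L ->
  cdim_le K k -> cdim_le L k -> cdim_le (K `|` L) k.
Proof.
move=> cK cL Kk Lk I U oU KLU.
have half K' L' (W : I -> set T) : closed K' -> cdim_le K' k ->
    (forall i, open (W i)) -> (forall x, (K' `|` L') x -> exists i, W i x) ->
    exists V : I -> set T, [/\ forall i, open (V i), forall i, V i `<=` W i,
    forall x, (K' `|` L') x -> exists i, V i x &
    forall x (J : {set I}), K' x -> (forall j, j \in J -> V j x) ->
      (#|J| <= k.+1)%N].
  move=> cK' K'k oW KW.
  have [|V [oV VW KV H]] := K'k I W oW; first by move=> x Kx; apply: KW; left.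
  exists (fun i => V i `|` (W i `&` ~` K')); split.
  - by move=> i; apply: openU => //; apply: openI => //; exact: closed_openC.
  - by move=> i x [/VW//|[]].
  - move=> x KLx; have [/KV[i Vix]|nKx] := pselect (K' x).
      by exists i; left.
    by have [i Wix] := KW _ KLx; exists i; right.
  - move=> x J Kx JV; apply: (H x) => // j /JV[//|[_ /(_ Kx)]//].
have [V [oV VU KLV VK]] := half K L U cK Kk oU KLU.
have [|W [oW WV LKW WL]] := half L K V cL Lk oV.
  by rewrite setUC.
exists W; split => //.
- by move=> i; apply: subset_trans (WV i) (VU i).
- by rewrite setUC.
move=> x J [Kx|Lx] JW; last exact: (WL x).
by apply: (VK x) => // j /JW/WV.
Qed.

Lemma cdim_le_bigU (I : Type) (s : seq I) (K : I -> set T) k :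
  (forall i, closed (K i)) -> (forall i, cdim_le (K i) k) ->
  cdim_le (\big[setU/set0]_(i <- s) K i) k.
Proof.
move=> cK Kk; elim: s => [|i s IH].
  by rewrite big_nil => J U oU _; exists U; split => // x; rewrite ?inE.
rewrite big_cons; apply: cdim_leU => //.
by apply: (big_ind (@closed T)) => //; [exact: closed0|exact: closedU].
Qed.

(* An indexed shrinking of a cover by k.+2 sets with empty intersection is
   pulled back along r, which forces some index of J to be missed. *)
Lemma cdim_le_small K k :
  (forall O : 'I_k.+2 -> set T, (forall l, open (O l)) ->
     (forall x, K x -> exists l, O l x) ->
   exists W : 'I_k.+2 -> set T, [/\ forall l, open (W l),
     forall l, W l `<=` O l, forall x, K x -> exists l, W l x &
     forall x, K x -> exists l, ~ W l x]) -> cdim_le K k.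
Proof.
move=> small I U oU KU.
suff [V [oV VU KV VJ]] : exists V : I -> set T, [/\ forall i, open (V i),
    forall i, V i `<=` U i, forall x, K x -> exists i, V i x &
    forall J, J \in enum {set I} -> (k.+1 < #|J|)%N ->
      forall x, K x -> exists2 j, j \in J & ~ V j x].
  exists V; split => // x J Kx JV; rewrite leqNgt; apply/negP => kJ.
  by have [|j /JV Vj] := VJ J _ kJ x Kx; rewrite ?mem_enum.
(* One pass for each J. Every pass only shrinks V, so what earlier passes achieved survives. *)
elim: (enum {set I}) => [|J s [V [oV VU KV Vs]]].
  by exists U; split => // J.
have [kJ|Jk] := ltnP k.+1 #|J|; last first.
  exists V; split => // J'; rewrite in_cons => /predU1P[->|]; last exact: Vs.
  by rewrite ltnNge Jk.
(* The first k+2 members of J get distinct indices; [inord] sends every other i to 0. *)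
pose r i : 'I_k.+2 := inord (index i (enum J)).
pose O l := \bigcup_(i in [set i | r i = l]) V i.
have [||W [oW WO KW W0]] := small O.
- by move=> l; apply: bigcup_open.
- by move=> x /KV[i Vix]; exists (r i), i.
exists (fun i => V i `&` W (r i)); split.
- by move=> i; exact: openI.
- by move=> i x [/VU].
- by move=> x /KW[l Wlx]; have [i /= ril Vix] := WO _ _ Wlx; exists i; rewrite ril.
move=> J'; rewrite in_cons => /predU1P[->|J's] kJ' x Kx; last first.
  by have [j jJ' nVj] := Vs _ J's kJ' _ Kx; exists j => // -[].
have [l nWl] := W0 _ Kx.
have lJ : (l < size (enum J))%N by rewrite -cardE (leq_trans _ kJ).
have [i0 _] : exists i, i \in enum J.
  by case: (enum J) lJ => // a ? _; exists a; rewrite mem_head.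
exists (nth i0 (enum J) l); first by rewrite -mem_enum mem_nth.
by rewrite /r index_uniq ?enum_uniq// inord_val => -[].
Qed.

End cdim_le.

(* No map from K to the cube [-1, 1]^d is essential. *)
Definition inessential (R : realType) (T : topologicalType) (d : nat)
    (K : set T) : Prop :=
  forall g : 'I_d -> T -> R, (forall i, continuous (g i)) ->
  exists h : 'I_d -> T -> R, [/\ forall i, continuous (h i),
    forall i x, K x -> 1 <= g i x -> 0 < h i x,
    forall i x, K x -> g i x <= -1 -> h i x < 0 &
    forall x, K x -> exists i, h i x != 0].

Section inessential.
Context {R : realType} {T : pseudoMetricType R}.
Implicit Types (K : set T) (k : nat).

(** The cover by sign patterns [O b] is shrunk to order k+1, and [q i] measures how deep x lies in
    the sets with positive i-th sign. Near the face g i >= 1 only such sets occur and [q i] is at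
    least c; near the opposite face none occurs and [q i] is 0. Subtracting distinct levels [t i]
    between 0 and c gives h. *)
Lemma cdim_le_inessential K k : compact K -> cdim_le K k ->
  inessential R k.+1 K.
Proof.
move=> cK Kk g cg.
pose O (b : {ffun 'I_k.+1 -> bool}) :=
  [set x | forall i, if b i then -1 < g i x else g i x < 1].
have oO b : open (O b).
  apply: (@open_forall _ _
    (fun i => [set x | if b i then -1 < g i x else g i x < 1])) => i.
  by case: (b i); apply: open_lt_fun => // x; exact: cvg_cst.
have KO x : K x -> exists b, O b x.
  move=> _; exists [ffun i => -1 < g i x] => i /=; rewrite ffunE.
  by case: ifPn => //; rewrite -leNgt => ?; lra.
have [V [oV VO KV Vk]] := Kk _ O oO KO.
have [c c0 cV] := Lebesgue_number cK oV KV.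
pose q i x := \big[Num.max/0]_(b : {ffun 'I_k.+1 -> bool} | b i) bump (V b) x.
pose t (i : 'I_k.+1) := c * i.+1%:R / k.+2%:R.
have t0 i : 0 < t i by rewrite divr_gt0// mulr_gt0.
have tc i : t i < c.
  by rewrite /t -mulrA gtr_pMr// ltr_pdivrMr// mul1r ltr_nat ltnS.
have tinj : injective t.
  move=> i j /(congr1 (fun x => x * k.+2%:R / c)).
  rewrite /t !divfK ?pnatr_eq0// ![c * _]mulrC !mulfK ?gt_eqF//.
  by move=> /eqP; rewrite eqr_nat eqSS => /eqP/val_inj.
have in_sign (b : {ffun 'I_k.+1 -> bool}) i x : 0 < bump (V b) x ->
    if b i then -1 < g i x else g i x < 1.
  by move=> /bump_gt0_in/VO/(_ i).
exists (fun i x => q i x - t i); split.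
- move=> i; apply: continuous_subr; last exact: cst_continuous.
  by apply: continuous_bigmaxr => b; exact: bump_continuous.
- move=> i x Kx gx; rewrite subr_gt0; have [b cb] := cV _ Kx.
  have bi : b i.
    have := @in_sign b i x (lt_le_trans c0 cb); case: ifP => // _ ?; lra.
  apply: lt_le_trans (tc i) _; apply: le_trans cb _.
  exact: (le_bigmax_cond _ (fun b => bump (V b) x)).
- move=> i x Kx gx; rewrite subr_lt0; apply: le_lt_trans (t0 i).
  apply: bigmax_le => // b bi; rewrite leNgt; apply/negP => /(in_sign b i).
  by rewrite bi => ?; lra.
- move=> x Kx; apply: contrapT => /forallNP H.
  have qt i : q i x = t i by have /negP := H i; rewrite negbK subr_eq0 => /eqP.
  have /choice[j jP] i : exists b, bump (V b) x = t i.
    have [b _ qb] := @eq_bigmax _ _ _ 0 [ffun=> true]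
      (fun b : {ffun 'I_k.+1 -> bool} => b i) (fun b => bump (V b) x)
      (ffunE _ _) (fun b _ => bump_ge0 _ _).
    by exists b; rewrite -qb -/(q i x) qt.
  have [b cb] := cV _ Kx.
  have jinj : injective j by move=> i i' jj; apply: tinj; rewrite -!jP jj.
  (* A common zero lies in k+1 different sets, one at each level [t i], and in one more at a level
     of at least c: too many by one. *)
  have := Vk x (b |: [set j i | i in 'I_k.+1])%SET Kx.
  rewrite cardsU1 card_imset// card_ord.
  have -> : b \notin [set j i | i in 'I_k.+1]%SET.
    apply/imsetP => -[i _ bi]; move: cb; rewrite bi jP leNgt.
    by rewrite tc.
  rewrite ltnn => H'; suff : false by []; apply: H' => b'.
  rewrite !inE => /predU1P[->|/imsetP[i _ ->]]; apply: bump_gt0_in.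
    exact: lt_le_trans cb.
  by rewrite jP.
Qed.

(** Each set of a cover by k+2 sets is cut down to where its function is not the smallest, so the
    index of the smallest value is always missed. The result still covers K unless all k+2 functions
    agree somewhere; inessentiality, applied to their differences from the last one, removes such
    coincidences. *)
Lemma inessential_cdim_le K k : compact K -> inessential R k.+1 K ->
  cdim_le K k.
Proof.
move=> cK Kk; apply: cdim_le_small => O oO KO.
have [c c0 cO] := Lebesgue_number cK oO KO.
pose p l := bump (O l).
have cp l : continuous (p l) by exact: bump_continuous.
(* The factor 4 / c yields [G x >= 2] wherever some [p l] with x in K vanishes, because another one
   is at least c there. *)
pose g l x := (4 / c) * (p l x - p ord_max x).
have cg l : continuous (g l).
  by apply: continuous_mulr; [exact: cst_continuous|exact: continuous_subr].
have [h [ch hpos hneg h0]] := Kk (fun i => g (lift ord_max i)) (fun i => cg _).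
pose G x := \big[Num.max/0]_(l < k.+2) `|g l x|.
have cG : continuous G.
  by apply: continuous_bigmaxr => l; exact: continuous_normr.
(* The weight is 0 for G <= 1 and 1 for G >= 2, so that q passes from h in the centre to g near the
   boundary. *)
pose lam x := Num.min 1 (Num.max 0 (G x - 1)).
have clam : continuous lam.
  apply: continuous_minr; first exact: cst_continuous.
  apply: continuous_maxr; first exact: cst_continuous.
  by apply: continuous_subr => //; exact: cst_continuous.
pose q l x := if unlift ord_max l is Some i then
  lam x * g l x + (1 - lam x) * h i x else 0.
have qlift i x : q (lift ord_max i) x =
  lam x * g (lift ord_max i) x + (1 - lam x) * h i x by rewrite /q liftK.
have qmax x : q ord_max x = 0 by rewrite /q unlift_none.
have gmax x : g ord_max x = 0 by rewrite /g subrr mulr0.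
have cq l : continuous (q l).
  rewrite /q; case: (unlift ord_max l) => [i|]; last exact: cst_continuous.
  apply: continuous_addr; apply: continuous_mulr => //.
  by apply: continuous_subr => //; exact: cst_continuous.
have lam0 x : 0 <= lam x by rewrite le_min ler01 le_max lexx.
have lam1 x : lam x <= 1 by rewrite ge_min lexx.
have gG l x : `|g l x| <= G x by exact: (le_bigmax _ (fun l => `|g l x|)).
(* Where both g and h contribute, G exceeds 1. In the coordinate that attains G, g and h have the
   same sign and cannot cancel. *)
have q0 x : K x -> exists i, q (lift ord_max i) x != 0.
  move=> Kx; have [lx|lx] := leP (lam x) 0.
    have [i hi] := h0 _ Kx; exists i.
    have l0 : lam x = 0 by apply/eqP; rewrite eq_le lx lam0.
    by rewrite qlift l0 mul0r add0r subr0 mul1r.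
  have G1 : 1 < G x by move: lx; rewrite lt_min ltr01/= lt_max ltxx/= subr_gt0.
  have [l _ Gl] := @eq_bigmax _ _ _ 0 ord_max xpredT
    (fun l => `|g l x|) isT (fun l _ => normr_ge0 _).
  case: (unliftP ord_max l) Gl => [i ->|->]; last first.
    by rewrite gmax normr0 -/(G x) => G0; exfalso; move: G1; rewrite G0; lra.
  rewrite -/(G x) => Gi; exists i; rewrite qlift.
  have [gi|gi] := leP 0 (g (lift ord_max i) x).
    have gi1 : 1 < g (lift ord_max i) x by rewrite -(ger0_norm gi) -Gi.
    have hi := hpos i x Kx (ltW gi1).
    have lg := mulr_gt0 lx (lt_trans ltr01 gi1).
    have lh : 0 <= (1 - lam x) * h i x by rewrite mulr_ge0 ?subr_ge0// ltW.
    by rewrite gt_eqF// ltr_pwDl.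
  have gi1 : g (lift ord_max i) x < -1 by rewrite ltrNr -(ltr0_norm gi) -Gi.
  have hi := hneg i x Kx (ltW gi1).
  have lg : lam x * g (lift ord_max i) x < 0 by rewrite pmulr_rlt0.
  have lh : (1 - lam x) * h i x <= 0 by rewrite mulr_ge0_le0 ?subr_ge0// ltW.
  by rewrite lt_eqF// -oppr_gt0 opprD ltr_pwDl ?oppr_gt0 ?oppr_ge0.
exists (fun l => [set x | exists j, q j x < q l x] `&` O l); split.
- move=> l; apply: openI => //.
  have -> : [set x | exists j, q j x < q l x] =
      \bigcup_j [set x | q j x < q l x].
    by apply/seteqP; split => x [j]; [exists j|move=> _; exists j].
  by apply: bigcup_open => j _; exact: open_lt_fun.
- by move=> l x [].
- move=> x Kx.
  have [l _ ql] : exists2 l, true & forall j, q j x <= q l x.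
    by case: (@arg_maxP _ _ _ ord0 xpredT (fun l => q l x)) => // l _ lmax;
      exists l => // j; exact: lmax.
  have [j qj] : exists j, q j x < q l x.
    apply: contrapT => /forallNP H.
    have qE j : q j x = q l x.
      by apply/eqP; rewrite eq_le ql leNgt; apply/negP; exact: H.
    by have [i] := q0 _ Kx; rewrite qE -(qE ord_max) qmax eqxx.
  exists l; split; first by exists j.
  (* Outside [O l] the function p l is 0, so g l is smallest; there q equals g, and l could not be
     above any other index. *)
  apply: contrapT => /bump_out pl0.
  have gmin j' : g l x <= g j' x.
    by rewrite /g ler_pM2l ?divr_gt0// lerD2r /p pl0 bump_ge0.
  have G2 : 2 <= G x.
    have [l' cl'] := cO _ Kx.
    have [pm|pm] := leP (p ord_max x) (c / 2).
      apply: le_trans (gG l' x); rewrite (le_trans _ (ler_norm _))// /g.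
      rewrite mulrAC ler_pdivlMr//; move: cl'; rewrite -/(p l' x); nra.
    apply: le_trans (gG l x); rewrite -normrN (le_trans _ (ler_norm _))// /g.
    rewrite /p pl0 -/(p ord_max x) sub0r mulrN opprK mulrAC ler_pdivlMr//; nra.
  have lam1' : lam x = 1 by rewrite /lam; apply/min_idPl; rewrite le_max; lra.
  have qg j' : q j' x = g j' x.
    case: (unliftP ord_max j') => [i ->|->]; last by rewrite qmax gmax.
    by rewrite qlift lam1' mul1r subrr mul0r addr0.
  by move: qj; rewrite !qg ltNge gmin.
- move=> x Kx; case: (@arg_minP _ _ _ ord0 xpredT (fun l => q l x)) => // l _ lmin.
  by exists l => -[[j]]; rewrite ltNge lmin.
Qed.

End inessential.

Lemma ex_subset_card (I : finType) (J : {set I}) m : (m <= #|J|)%N ->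
  exists2 L : {set I}, L \subset J & #|L| = m.
Proof.
move=> mJ; exists [set x in take m (enum J)]%SET.
  by apply/fintype.subsetP => x; rewrite inE => /mem_take; rewrite mem_enum.
rewrite cardsE (card_uniqP _) ?take_uniq ?enum_uniq// size_takel//.
by rewrite -cardE.
Qed.

(** A refinement becomes an indexed shrinking by uniting all its members assigned to the same i. A
    point in the united sets for all i in J lies in members with pairwise distinct indices, so the
    order does not grow. The map iota is the identity for X and the inclusion for an image. *)
Lemma covering_dim_leP (S T : topologicalType) (iota : S -> T) k :
  (forall O : set S, open O <-> exists2 A : set T, open A & iota @^-1` A = O) ->
  covering_dim_le S k <-> cdim_le (range iota) k.
Proof.
move=> oST; have oiota A : open A -> open (iota @^-1` A).
  by move=> oA; apply/oST; exists A.
split=> [Sk I U oU iU|Tk m U oU SU].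
  pose U' (i : 'I_#|I|) := iota @^-1` U (enum_val i).
  have [||p [V [oV VT VU V0]]] := Sk _ U'.
  - by move=> i; exact: oiota.
  - apply/seteqP; split => // s _; have [|i Ui] := iU (iota s); first by exists s.
    by exists (enum_rank i) => //; rewrite /U' enum_rankK.
  have /choice[c cP] := VU.
  have /choice[A AP] j : exists A, open A /\ iota @^-1` A = V j.
    by have /oST[A oA AV] := oV j; exists A.
  exists (fun i => U i `&` \bigcup_(j in [set j | enum_val (c j) = i]) A j).
  split=> [i|i x []//|_ [s _ <-]|_ J [s _ <-] JA].
  - by apply: openI => //; apply: bigcup_open => j _; case: (AP j).
  - have [j _ Vj] : (\bigcup_j V j) s by rewrite VT.
    exists (enum_val (c j)); split; first exact: cP.
    by exists j => //; have [_ AV] := AP j; rewrite -AV in Vj.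
  have [j0 _ _] : (\bigcup_j V j) s by rewrite VT.
  have /choice[j jP] i : exists j, i \in J -> V j s /\ enum_val (c j) = i.
    have [iJ|] := boolP (i \in J); last by exists j0.
    have [_ [j ji Aj]] := JA i iJ; exists j => _; split => //.
    by have [_ <-] := AP j.
  rewrite leqNgt; apply/negP => kJ.
  have jinj : {in J &, injective j}.
    move=> i i' iJ i'J ji; have [_ <-] := jP i iJ.
    by have [_ <-] := jP i' i'J; rewrite ji.
  have [|L LJ Lk] := @ex_subset_card _ (j @: J)%SET k.+2.
    by rewrite card_in_imset.
  suff : set0 s by []; rewrite -(V0 L Lk) => l /= lL.
  by have /imsetP[i iJ ->] := fintype.subsetP LJ _ lL; have [] := jP i iJ.
have /choice[A AP] i : exists A, open A /\ iota @^-1` A = U i.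
  by have /oST[A oA AU] := oU i; exists A.
have [||V [oV VA iV Vk]] := Tk _ A.
- by move=> i; have [] := AP i.
- move=> _ [s _ <-]; have [i _ Ui] : (\bigcup_i U i) s by rewrite SU.
  by exists i; have [_ AU] := AP i; rewrite -AU in Ui.
exists m, (fun i => iota @^-1` V i); split => [i||i|J Jk].
- exact: oiota.
- apply/seteqP; split => // s _; have [|i Vi] := iV (iota s); first by exists s.
  by exists i.
- by exists i; have [_ <-] := AP i => s; exact: VA.
- apply/seteqP; split => // s VJ.
  have := Vk (iota s) J; rewrite Jk ltnn => F; suff : false by [].
  by apply: F => [|j jJ]; [exists s|exact: VJ].
Qed.

Lemma covering_dim_leT (T : topologicalType) k :
  covering_dim_le T k <-> cdim_le [set: T] k.
Proof.
have -> : [set: T] = range (@id T) by rewrite image_id.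
by apply: covering_dim_leP => O; split => [oO|[A oA <-]//]; exists O.
Qed.

Lemma covering_dim_le_set_type (T : topologicalType) (K : set T) k :
  covering_dim_le (set_type K) k <-> cdim_le K k.
Proof.
have KE : range (@set_val T K) = K.
  apply/seteqP; split => [_ [s _ <-]|x Kx]; first exact: set_valP.
  by exists (SigSub (mem_set Kx)).
rewrite -[in X in _ <-> X]KE; exact: covering_dim_leP.
Qed.

(** * Values of the topological dimension *)

Section topological_dim.
Context {R : realType} {T : topologicalType}.
Local Open Scope ereal_scope.
Local Notation tdim := (@topological_dim R T).

Lemma topological_dim_ge0 : 0 <= tdim.
Proof. by apply: le_ereal_inf_tmp => _ [k _ <-]; rewrite lee_fin. Qed.

Lemma topological_dim_le k : covering_dim_le T k -> tdim <= k%:R%:E.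
Proof. by move=> Tk; apply: ereal_inf_lbound; exists k. Qed.

Lemma topological_dim_lt k : tdim < k%:R%:E ->
  exists2 j, (j < k)%N & covering_dim_le T j.
Proof.
move=> /ereal_inf_lt[_ [j Tj <-]]; rewrite lte_fin ltr_nat => jk.
by exists j.
Qed.

Lemma topological_dim_nat k : tdim < k%:R%:E ->
  exists2 j, covering_dim_le T j & tdim = j%:R%:E.
Proof.
move=> /topological_dim_lt[i _ Ti].
have exi : exists i, `[< covering_dim_le T i >] by exists i; apply/asboolP.
case: (ex_minnP exi) => j /asboolP Tj jmin; exists j => //.
apply/eqP; rewrite eq_le topological_dim_le//=.
by apply: le_ereal_inf_tmp => _ [l /= Tl <-];
  rewrite lee_fin ler_nat jmin//; exact/asboolP.
Qed.

End topological_dim.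

(** * The Poincare-Miranda theorem *)

Section cup_product.
Local Open Scope nat_scope.
Implicit Types (x : nat -> nat) (f : (nat -> nat) -> bool).
Local Notation point := (nat -> nat).
Local Notation "\bsum_ ( i <- r | P ) F" := (\big[addb/false]_(i <- r | P) F)
  (at level 41, F at level 41, i, r at level 50).
Local Notation "\bsum_ ( i <- r ) F" := (\big[addb/false]_(i <- r) F)
  (at level 41, F at level 41, i, r at level 50).
Local Notation "\bsum_ ( i < n ) F" := (\big[addb/false]_(i < n) F)
  (at level 41, F at level 41, i, n at level 50).

Definition upd x a t : point := fun i => if i == a then t else x i.
Definition inc x a := upd x a (x a).+1.

(** For s running through the orderings of the coordinates, these are the simplices of the
    Freudenthal triangulation of the unit cube with lowest corner x. *)
Fixpoint verts x (s : seq nat) : seq point :=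
  x :: if s is a :: s' then verts (inc x a) s' else [::].

(* The value on the simplex vs of the mod 2 cup product of the coboundaries
   of the functions fs. *)
Fixpoint cup (fs : seq (point -> bool)) (vs : seq point) : bool :=
  match fs, vs with
  | [::], [:: _] => true
  | f :: fs', u :: ((v :: _) as vs') => (f u (+) f v) && cup fs' vs'
  | _, _ => false
  end.

(** The product of the 0-cochain f with the cocycle [cup fs]: a primitive of [cup (f :: fs)]. *)
Definition cup0 f fs (vs : seq point) : bool :=
  if vs is u :: _ then f u && cup fs vs else false.

Definition omit j (vs : seq point) := take j vs ++ drop j.+1 vs.

(** The Leibniz rule modulo 2: a product of coboundaries is closed. All faces but the first two
    share the factor f u + f v. *)
Lemma cup_cocycle fs vs : size vs = (size fs).+2 ->
  \bsum_(j < (size fs).+2) cup fs (omit j vs) = false.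
Proof.
elim: fs vs => [|f fs IH] [|u [|v vs]]//.
  by case: vs => // _; rewrite !big_ord_recl big_ord0.
case: vs => // w vs [sz]; rewrite big_ord_recl big_ord_recl.
have := IH (v :: w :: vs); rewrite /= sz => /(_ erefl).
rewrite big_ord_recl {1}/omit /= => /esym /(congr1 (addb (cup fs (w :: vs)))).
rewrite addbA addbb addbF addFb => E.
rewrite /omit /=.
have -> : \bsum_(i < (size fs).+1)
    cup (f :: fs) (omit (lift ord0 (lift ord0 i)) [:: u, v, w & vs]) =
  (f u (+) f v) && \bsum_(i < (size fs).+1) cup fs (omit (lift ord0 i) [:: v, w & vs]).
  by rewrite big_distrr.
by rewrite -E; case: (f u); case: (f v); case: (f w); case: (cup _ _).
Qed.

Lemma cup_coboundary f fs vs : size vs = (size fs).+2 ->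
  \bsum_(j < (size fs).+2) cup0 f fs (omit j vs) = cup (f :: fs) vs.
Proof.
case: vs => [|u [|v vs]]// sz; have := cup_cocycle sz.
rewrite !(big_ord_recl (size fs).+1) {1}/omit /=.
move=> /(congr1 (addb (cup fs (v :: vs)))).
rewrite addbA addbb addFb addbF => E.
have -> : \bsum_(i < (size fs).+1) cup0 f fs (omit (lift ord0 i) [:: u, v & vs]) =
  f u && \bsum_(i < (size fs).+1) cup fs (omit (lift ord0 i) [:: u, v & vs]).
  by rewrite big_distrr.
rewrite /= E /omit /=.
by case: (f u); case: (f v); case: (cup _ _).
Qed.

Fixpoint swap j (s : seq nat) := match j, s with
  | 0, a :: b :: r => b :: a :: r
  | j.+1, a :: r => a :: swap j r
  | _, _ => s
  end.

Lemma swapK j : involutive (swap j).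
Proof. by elim: j => [|j IH] [|a [|b r]]//=; rewrite ?IH// -(IH (b :: r)). Qed.

Lemma perm_swap j s : perm_eq (swap j s) s.
Proof.
elim: j s => [|j IH] [|a r] //=; last by rewrite perm_cons IH.
by case: r => // b r; rewrite (perm_catCA [:: b] [:: a]).
Qed.

Lemma inc_comm x a b : inc (inc x a) b = inc (inc x b) a.
Proof.
apply/funext => i; rewrite /inc /upd /=; have [->|ab] := eqVneq a b; first by [].
by case: (eqVneq i a) => // ->; rewrite (negbTE ab).
Qed.

Lemma omit_swap j x s :
  omit j.+1 (verts x (swap j s)) = omit j.+1 (verts x s).
Proof.
elim: j x s => [|j IH] x [|a r]//=.
  by case: r => // b r; rewrite /omit /= inc_comm.
by have := IH (inc x a) r; rewrite /omit /= => ->.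
Qed.

Lemma ltn_swap j s : uniq s -> j.+1 < size s ->
  (nth 0 (swap j s) j < nth 0 (swap j s) j.+1) = ~~ (nth 0 s j < nth 0 s j.+1).
Proof.
elim: j s => [|j IH] [|a [|b r]]//=.
  by rewrite in_cons negb_or => /andP[/andP[ab _] _] _; case: ltngtP ab.
by move=> /andP[_ u] sz; rewrite IH.
Qed.

(** The involution [swap j] exchanges the orderings that ascend at position j with those that
    descend there, so the terms cancel in pairs. *)
Lemma bsum_swap (D : seq nat) j (G : seq nat -> bool) : uniq D ->
  j.+1 < size D -> (forall s, G (swap j s) = G s) ->
  \bsum_(s <- permutations D) G s = false.
Proof.
move=> uD jD GE; pose c s := nth 0 s j < nth 0 s j.+1.
rewrite (bigID c) /=.
suff -> : \bsum_(s <- permutations D | ~~ c s) G s =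
  \bsum_(s <- permutations D | c s) G s by rewrite addbb.
rewrite (perm_big (map (swap j) (permutations D))); last first.
  apply: uniq_perm; first exact: permutations_uniq.
    by rewrite map_inj_uniq ?permutations_uniq//; exact: inv_inj (swapK j).
  move=> s; rewrite mem_permutations; apply/idP/mapP => [sD|[s' + ->]].
    exists (swap j s); last by rewrite swapK.
    by rewrite mem_permutations (permPl (perm_swap _ _)).
  by rewrite mem_permutations => sD; rewrite (permPl (perm_swap _ _)).
rewrite big_map; under eq_bigr do rewrite GE.
rewrite big_seq_cond [RHS]big_seq_cond; apply: eq_bigl => s.
rewrite mem_permutations; case: (boolP (perm_eq s D)) => //= sD.
by rewrite /c ltn_swap ?negbK// ?(perm_uniq sD)// (perm_size sD).
Qed.

Lemma omit_last x s a : omit (size s).+1 (verts x (rcons s a)) = verts x s.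
Proof.
elim: s x => [|b s IH] x; first by [].
by have := IH (inc x b); rewrite /omit /= => ->.
Qed.

Lemma size_verts x s : size (verts x s) = (size s).+1.
Proof. by elim: s x => //= a s IH x; rewrite IH. Qed.

(* Interior faces of the Freudenthal triangulation cancel in pairs; the first
   and last faces are paired up by rotating the directions. *)
Lemma bsum_cup f fs x (D : seq nat) : uniq D -> size D = (size fs).+1 ->
  \bsum_(s <- permutations D) cup (f :: fs) (verts x s) =
  \bsum_(s <- permutations D)
    (cup0 f fs (verts (inc x (last 0 s)) (take (size fs) s)) (+)
     cup0 f fs (verts x (take (size fs) s))).
Proof.
move=> uD szD.
under eq_big_seq => s.
  rewrite mem_permutations => sD.
  rewrite -cup_coboundary ?size_verts ?(perm_size sD) ?szD//.
  over.
rewrite /= exchange_big /= big_ord_recl big_ord_recr /=.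
rewrite [X in _ (+) (X (+) _)]big1 ?addFb => [|i _]; last first.
  rewrite (@bsum_swap _ i)//; first by rewrite szD ltnS ltn_ord.
  by move=> s; rewrite /= /fintype.bump /= add1n omit_swap.
rewrite big_split /=; congr addb; last first.
  apply: eq_big_seq => s; rewrite mem_permutations => sD.
  have := perm_size sD; case/lastP: s {sD} => [|s a]; rewrite szD// size_rcons => -[ss].
  by rewrite /fintype.bump /= add1n -ss omit_last -cats1 take_size_cat.
rewrite (perm_big (map (rotr 1) (permutations D))); last first.
  apply: uniq_perm; first exact: permutations_uniq.
    by rewrite map_inj_uniq ?permutations_uniq//; exact: rotr_inj.
  move=> s; rewrite mem_permutations; apply/idP/mapP => [sD|[s' + ->]].
    by exists (rot 1 s); rewrite ?rotK// mem_permutations perm_rot.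
  by rewrite mem_permutations perm_rotr.
rewrite big_map; apply: eq_big_seq => s; rewrite mem_permutations => sD.
have := perm_size sD; rewrite szD; case/lastP: s {sD} => [|s a]; first by [].
rewrite size_rcons => -[ss].
by rewrite rotr1_rcons /omit /= drop0 last_rcons -ss -cats1 take_size_cat.
Qed.

(** The factor belonging to a is the difference of two values of [f a], both equal to c. *)
Lemma cup_const (f : nat -> point -> bool) c a (D s : seq nat) x : a \in D ->
  (forall y, (forall i, x i <= y i <= x i + count_mem i s) -> f a y = c) ->
  cup (map f D) (verts x s) = false.
Proof.
elim: D x s => // b D IH x [|e s] aD fc; first by case: (map f D).
have fe y : (forall i, inc x e i <= y i <= inc x e i + count_mem i s) ->
    f a y = c.
  move=> xy; apply: fc => i; have := xy i; rewrite /inc /upd /=.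
  by rewrite [e == i]eq_sym; case: (eqVneq i e) => [->|_] /=; lia.
have -> : cup (map f (b :: D)) (verts x (e :: s)) =
  (f b x (+) f b (inc x e)) && cup (map f D) (verts (inc x e) s).
  by case: s {fc fe}.
move: aD; rewrite in_cons => /predU1P[ab|aD]; last by rewrite (IH _ _ aD) ?andbF.
rewrite -ab fc => [|i]; last by lia.
by rewrite fe ?addbb// => i; lia.
Qed.

Variable N : nat.

Fixpoint box (l : seq nat) (F : point -> bool) x : bool :=
  if l is a :: l' then \bsum_(t < N) box l' F (upd x a t) else F x.

Lemma eq_box l F F' x :
  (forall y, (forall i, i \in l -> y i < N) ->
    (forall i, i \notin l -> y i = x i) -> F y = F' y) ->
  box l F x = box l F' x.
Proof.
elim: l x => [|a l IH] x FF /=; first by apply: FF.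
apply: eq_bigr => t _; apply: IH => y yN yx; apply: FF => i.
  rewrite in_cons => /predU1P[->|/yN//].
  have [/yN//|/yx ->] := boolP (a \in l).
  by rewrite /upd eqxx.
by rewrite in_cons negb_or => /andP[ia /yx ->]; rewrite /upd (negbTE ia).
Qed.

Lemma box_false l x : box l (fun=> false) x = false.
Proof. by elim: l x => //= a l IH x; rewrite big1. Qed.

Lemma box_add l F F' x :
  box l (fun y => F y (+) F' y) x = box l F x (+) box l F' x.
Proof.
elim: l x => //= a l IH x; rewrite -big_split /=.
by apply: eq_bigr => t _; exact: IH.
Qed.

Lemma box_sum l (T : Type) (r : seq T) (G : T -> point -> bool) x :
  box l (fun y => \bsum_(s <- r) G s y) x = \bsum_(s <- r) box l (G s) x.
Proof.
elim: r => [|s r IH].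
  rewrite big_nil; transitivity (box l (fun=> false) x); last exact: box_false.
  by apply: eq_box => y _ _; rewrite big_nil.
rewrite big_cons -IH -box_add; apply: eq_box => y _ _.
by rewrite big_cons.
Qed.

Lemma updC x a b s t : a != b -> upd (upd x a s) b t = upd (upd x b t) a s.
Proof.
move=> ab; apply/funext => i; rewrite /upd.
by case: (eqVneq i a) => // ->; rewrite (negbTE ab).
Qed.

Lemma box_rem l F x a : a \in l -> box l F x = box (a :: rem a l) F x.
Proof.
elim: l x => // b l IH x; rewrite in_cons /=.
case: eqVneq => [->|ab] //= al.
under eq_bigr do rewrite IH//=.
rewrite exchange_big /=; apply: eq_bigr => t _; apply: eq_bigr => s _.
by rewrite updC// eq_sym.
Qed.

Lemma box_inc l F x a : a \notin l ->
  box l (fun y => F (inc y a)) x = box l F (inc x a).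
Proof.
elim: l x => //= b l IH x; rewrite in_cons negb_or => /andP[ab al].
apply: eq_bigr => t _; rewrite IH//; congr box; apply/funext => i.
by rewrite /inc /upd; case: (eqVneq i a) => [->|//]; rewrite (negbTE ab).
Qed.

Lemma box_telescope l F x a : a \notin l ->
  box (a :: l) (fun y => F (inc y a) (+) F y) x =
  box l F (upd x a N) (+) box l F (upd x a 0).
Proof.
move=> al; rewrite /=.
suff H n : \bsum_(t < n) box l (fun y => F (inc y a) (+) F y) (upd x a t) =
  box l F (upd x a n) (+) box l F (upd x a 0) by exact: H.
elim: n => [|n IH]; first by rewrite big_ord0 addbb.
rewrite big_ord_recr /= IH box_add box_inc//.
have -> : inc (upd x a n) a = upd x a n.+1.
  by apply/funext => i; rewrite /inc /upd eqxx; case: eqP.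
by rewrite addbC -addbA (addbA (box l F (upd x a n))) addbb.
Qed.

(** A discrete Stokes theorem with induction on the dimension. By [bsum_cup] the sum over all small
    simplices becomes a sum of differences, which telescopes to the faces of the big cube. Only the
    face where coordinate b equals N contributes, and its contribution is the same sum in one
    dimension less. *)
Lemma bsum_cube_odd (f : nat -> point -> bool) (D : seq nat) x : uniq D ->
  (forall a y, a \in D -> (forall i, i \in D -> y i <= N) ->
    (forall i, i \notin D -> y i = x i) ->
    (y a = 0 -> f a y = false) /\ (y a = N -> f a y = true)) ->
  box D (fun y => \bsum_(s <- permutations D) cup (map f D) (verts y s)) x.
Proof.
elim: D x => [|b D IH] x uD fD.
  by rewrite /= (_ : permutations [::] = [:: [::]])// big_seq1.
have bD : b \notin D by case/andP: uD.
(* On the face where coordinate a equals t, [f a] is constantly c. For a = b this fixes the factor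
   [f b] of [cup0]; for any other a it makes the product over D vanish. *)
have face c t a s y : perm_eq (rcons s a) (b :: D) ->
    (forall i, i \in rem a (b :: D) -> y i < N) ->
    (forall i, i \notin rem a (b :: D) -> y i = upd x a t i) ->
    (t, c) = (0, false) \/ (t, c) = (N, true) ->
    (a = b -> f b y = c) /\
    (a != b -> cup (map f D) (verts y s) = false).
  move=> sD yN yx tc; have aD : a \in b :: D.
    by rewrite -(perm_mem sD) mem_rcons mem_head.
  have rD i : (i \in rem a (b :: D)) = (i != a) && (i \in b :: D).
    by rewrite mem_rem_uniq// !inE.
  have ya : y a = t by rewrite yx ?rD ?eqxx// /upd eqxx.
  have yx' i : i \notin b :: D -> y i = x i.
    move=> iD; rewrite yx ?rD ?(negbTE iD) ?andbF// /upd.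
    by case: eqVneq => // ia; rewrite ia aD in iD.
  have fc z : (forall i, y i <= z i <= y i + count_mem i s) -> f a z = c.
    move=> yz; have us : uniq (rcons s a) by rewrite (perm_uniq sD).
    have cs i : count_mem i s = (i \in s).
      by rewrite count_uniq_mem//; move: us; rewrite rcons_uniq => /andP[].
    have as' : a \notin s by move: us; rewrite rcons_uniq => /andP[].
    have za : z a = t by have := yz a; rewrite cs (negbTE as') ya; lia.
    have [||z0 zN] := fD a z aD.
    - move=> i iD; have [ia|ia] := eqVneq i a.
        by rewrite ia za; case: tc => -[-> _].
      have := yz i; have := yN i; rewrite rD ia iD cs => /(_ isT).
      by case: (i \in s) => /=; lia.
    - move=> i iD; rewrite -yx'//; have := yz i; rewrite cs.
      have -> : i \in s = false.
        apply: contraNF iD => is'; rewrite -(perm_mem sD) mem_rcons in_cons.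
        by rewrite is' orbT.
      by lia.
    by case: tc => -[tE ->]; [apply: z0|apply: zN]; rewrite za.
  split=> [ab|ab]; first by rewrite -ab fc// => i; lia.
  apply: (@cup_const f c a) => //.
  by move: aD; rewrite in_cons (negbTE ab).
set F := fun y => _.
have -> : box (b :: D) F x = \bsum_(s <- permutations (b :: D)) box (b :: D)
    (fun y => cup0 (f b) (map f D) (verts (inc y (last 0 s)) (take (size D) s)) (+)
      cup0 (f b) (map f D) (verts y (take (size D) s))) x.
  rewrite -box_sum; apply: eq_box => y _ _.
  by rewrite /F [map f (b :: D)]/= bsum_cup ?size_map.
have -> : \bsum_(s <- permutations (b :: D)) box (b :: D)
    (fun y => cup0 (f b) (map f D) (verts (inc y (last 0 s)) (take (size D) s)) (+)
      cup0 (f b) (map f D) (verts y (take (size D) s))) x =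
    \bsum_(s <- [seq s <- permutations (b :: D) | last 0 s == b])
      box D (fun y => cup (map f D) (verts y (take (size D) s))) (upd x b N).
  rewrite big_filter [RHS]big_mkcond; apply: eq_big_seq => s.
  rewrite mem_permutations => sD.
  have := perm_size sD; case/lastP: s sD => [|s a] sD; first by [].
  rewrite size_rcons => -[ss]; rewrite last_rcons -ss -cats1 take_size_cat//.
  have aD : a \in b :: D by rewrite -(perm_mem sD) mem_rcons mem_head.
  have aND : a \notin rem a (b :: D) by rewrite mem_rem_uniqF.
  have sp y : verts y s = y :: behead (verts y s) by case: (s).
  rewrite (@box_rem _ _ _ _ aD).
  rewrite (@box_telescope _ (fun y => cup0 (f b) (map f D) (verts y s)))//.
  have -> : box (rem a (b :: D)) (fun y => cup0 (f b) (map f D) (verts y s))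
      (upd x a 0) = false.
    rewrite -(box_false (rem a (b :: D)) (upd x a 0)); apply: eq_box => y yN yx.
    have [fb cupF] := face false 0 a s y sD yN yx (or_introl erefl).
    have [ab|ab] := eqVneq a b; last first.
      by rewrite /cup0 cupF//; case: verts => // ? _; rewrite andbF.
    by rewrite /cup0 sp fb.
  rewrite addbF; case: (eqVneq a b) => ab.
    have rb : rem a (b :: D) = D by rewrite ab /= eqxx.
    rewrite rb -ab; apply: eq_box => y yN yx.
    have [|||fb _] := face true N a s y sD; rewrite ?rb//; first by right.
    by rewrite -ab in fb; rewrite /cup0 sp fb.
  rewrite -(box_false (rem a (b :: D)) (upd x a N)); apply: eq_box => y yN yx.
  have [_ cupF] := face true N a s y sD yN yx (or_intror erefl).
  by rewrite /cup0 cupF//; case: verts => // ? _; rewrite andbF.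
rewrite (perm_big (map (rcons^~ b) (permutations D))); last first.
  apply: uniq_perm; first by rewrite filter_uniq// permutations_uniq.
    rewrite map_inj_uniq ?permutations_uniq//.
    by move=> s t /rcons_inj[].
  move=> s; rewrite mem_filter mem_permutations.
  have rD t : perm_eq (rcons t b) (b :: D) = perm_eq t D.
    by rewrite perm_rcons perm_cons.
  apply/andP/mapP => [[/eqP]|[t + ->]].
    case/lastP: s => [|s a]; first by move=> _ /perm_size.
    rewrite last_rcons => ->; rewrite rD => sD.
    by exists s; rewrite ?mem_permutations.
  by rewrite mem_permutations last_rcons rD.
rewrite big_map; under eq_big_seq => s.
  rewrite mem_permutations => sD.
  rewrite -cats1 -(perm_size sD) take_size_cat//.
  over.
rewrite -box_sum; apply: IH; first by case/andP: uD.
move=> a y aD yN yx.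
have yb : y b = N by rewrite yx// /upd eqxx.
apply: fD; first by rewrite in_cons aD orbT.
  by move=> i; rewrite in_cons => /predU1P[->|/yN//]; rewrite yb.
move=> i; rewrite in_cons negb_or => /andP[ib iD].
by rewrite yx// /upd (negbTE ib).
Qed.

(** If every cell had a label that is constant on it, all terms of the odd sum would vanish by
    [cup_const]. *)
Lemma cubical_sperner (f : nat -> point -> bool) d :
  (forall l y, l < d -> (forall i, i < d -> y i <= N) ->
    (y l = 0 -> f l y = false) /\ (y l = N -> f l y = true)) ->
  exists2 y, (forall i, i < d -> y i < N) &
    forall l c, l < d ->
      ~ (forall z, (forall i, y i <= z i <= (y i).+1) -> f l z = c).
Proof.
move=> fd; apply: contrapT => H.
have := @bsum_cube_odd f (iota 0 d) (fun=> 0) (iota_uniq _ _).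
set b := box _ _ _; suff -> : b = false.
  move=> odd; suff : false by []; apply: odd => a y.
  rewrite mem_iota => ad yN _; apply: fd => // i id.
  by apply: yN; rewrite mem_iota.
transitivity (box (iota 0 d) (fun=> false) (fun=> 0)); last exact: box_false.
apply: eq_box => y yN _.
apply/negbTE/negP => cy; apply: H; exists y => [i id|l c ld flc].
  by apply: yN; rewrite mem_iota.
move: cy; rewrite big1_seq// => s /=; rewrite mem_permutations => sd.
apply: (@cup_const f c l); first by rewrite mem_iota.
move=> z yz; apply: flc => i; have := yz i.
rewrite count_uniq_mem ?(perm_uniq sd) ?iota_uniq//.
by case: (i \in s) => /=; lia.
Qed.

End cup_product.

(** * From grid labellings to continuous maps of a cube *)

Lemma continuous_compose (T U V : topologicalType) (f : T -> U) (g : U -> V) :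
  continuous f -> continuous g -> continuous (fun x => g (f x)).
Proof. by move=> cf cg x; apply: continuous_comp; [exact: cf|exact: cg]. Qed.

Lemma ball_rV (R : realType) n (x y : 'rV[R]_n) e : 0 < e ->
  (forall i, `|x ord0 i - y ord0 i| < e) -> ball x e y.
Proof. by move=> e0 xy; split => // i j; rewrite ord1; exact: xy. Qed.

Lemma continuous_rV (R : realType) (T : topologicalType) n
    (f : 'I_n -> T -> R) : (forall i, continuous (f i)) ->
  continuous (fun x => \row_i f i x : 'rV[R]_n).
Proof.
move=> cf x; apply/cvgrPdist_lt => e e0; near=> y.
have : ball (\row_i f i x : 'rV[R]_n) e (\row_i f i y); last first.
  by rewrite mx_norm_ball.
apply: ball_rV => // i; rewrite !mxE; move: i.
near: y; apply: filter_forall => i.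
by have /cvgrPdist_lt/(_ _ e0) := cf i x.
Unshelve. all: by end_near. Qed.

Lemma continuous_coord (R : realType) (T : topologicalType) n
    (f : T -> 'rV[R]_n) i : continuous f -> continuous (fun x => f x ord0 i).
Proof.
move=> cf; apply: (continuous_compose cf (g := fun v : 'rV[R]_n => v ord0 i)).
exact: coord_continuous.
Qed.

Lemma continuous_affine (R : realType) n (c : 'rV[R]_n) (e : R) :
  continuous (fun y : 'rV[R]_n => c + e *: y).
Proof.
have -> : (fun y : 'rV[R]_n => c + e *: y) =
    (fun y => \row_i (c ord0 i + e * y ord0 i)).
  by apply/funext => y; apply/rowP => i; rewrite !mxE.
apply: continuous_rV => i; apply: continuous_addr; first exact: cst_continuous.
apply: continuous_mulr; first exact: cst_continuous.
exact: coord_continuous.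
Qed.

(** If h had no zero, the sets where some coordinate of h has a fixed sign would cover the cube. On
    a grid finer than their Lebesgue number each cell would have a coordinate of constant sign,
    against [cubical_sperner] applied to the signs. *)
Lemma cube_essential (R : realType) n (K : set 'rV[R]_n) (c : 'rV[R]_n)
    (e : R) : 0 < e ->
  (forall y : 'rV[R]_n, (forall i, `|y ord0 i| <= 1) -> K (c + e *: y)) ->
  ~ inessential R n K.
Proof.
move=> e0 QK /(_ (fun i y => (y ord0 i - c ord0 i) / e)) [].
  move=> i; apply: continuous_mulr; last exact: cst_continuous.
  apply: continuous_subr; last exact: cst_continuous.
  exact: coord_continuous.
move=> h [ch hpos hneg h0].
pose Q := [set y : 'rV[R]_n | forall i, `|y ord0 i| <= 1].
have cQ : compact Q.
  have -> : Q = [set y : 'rV[R]_n | forall i, `[-1, 1]%classic (y ord0 i)].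
    by apply/seteqP; split => y yQ i; have := yQ i; rewrite /= in_itv/= ler_norml.
  have cQ := @rV_compact R n (fun=> `[(-1):R, 1]%classic).
  by apply: cQ => _; exact: segment_compact.
pose H i y := h i (c + e *: y).
have cH i : continuous (H i).
  apply: (@continuous_compose _ _ _ (fun y : 'rV[R]_n => c + e *: y) (h i)) => //.
  exact: continuous_affine.
pose U (ib : 'I_n * bool) :=
  if ib.2 then [set y | 0 < H ib.1 y] else [set y | H ib.1 y < 0].
have [||r r0 rU] := @Lebesgue_number _ _ _ U Q cQ.
- move=> [i b]; rewrite /U /=.
  case: b; first exact: open_lt_fun (@cst_continuous _ R^o 0) (cH i).
  exact: open_lt_fun (cH i) (@cst_continuous _ R^o 0).
- move=> y Qy; have [i] := h0 _ (QK _ Qy); rewrite neq_lt => /orP[hi|hi].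
    by exists (i, false).
  by exists (i, true).
(* The mesh 2 / N is below r / 2, so the vertices of a cell lie within r / 2 of its lowest corner in
   the maximum norm. *)
pose N := (Num.truncn (4 / r)).+1.
have N0 : 0 < N%:R :> R by [].
have Nr : 2 / N%:R < r / 2.
  rewrite ltr_pdivrMr//; have := truncnS_gt (4 / r); rewrite -/N.
  by rewrite ltr_pdivrMr// => ?; lra.
pose p (y : nat -> nat) : 'rV[R]_n := \row_(i < n) (2 / N%:R * (y i)%:R - 1).
have a0 : 0 < 2 / N%:R :> R by rewrite divr_gt0.
have aN : 2 / N%:R * N%:R = 2 :> R by rewrite divfK ?gt_eqF.
have pQ y : (forall i, (i < n)%N -> (y i <= N)%N) -> Q (p y).
  move=> yN i; rewrite mxE ler_norml.
  have y0 : 0 <= 2 / N%:R * (y i)%:R :> R by rewrite mulr_ge0// ltW.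
  have : 2 / N%:R * (y i)%:R <= 2 / N%:R * N%:R :> R.
    by rewrite ler_pM2l// ler_nat yN ?ltn_ord.
  by rewrite aN => ?; apply/andP; split; lra.
pose f l y := if insub l is Some i then 0 < H i (p y) else false.
have fE (i : 'I_n) y : f i y = (0 < H i (p y)) by rewrite /f valK.
have [l y ln yN|y yN fy] := @cubical_sperner N f n.
  rewrite -[l]/(val (Ordinal ln)) fE; set i := Ordinal ln; split => yl.
    apply/negbTE; rewrite -leNgt ltW//; apply: hneg; first exact/QK/pQ.
    rewrite !mxE [_ + e * _]addrC addrK mulrAC divff ?gt_eqF// mul1r.
    by rewrite yl mulr0 sub0r.
  apply: hpos; first exact/QK/pQ.
  rewrite !mxE [_ + e * _]addrC addrK mulrAC divff ?gt_eqF// mul1r.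
  by rewrite yl aN; lra.
have [|[i b] rb] := rU (p y); first by apply: pQ => i /yN/ltnW.
apply: (fy i b) => // z yz; rewrite fE.
have : U (i, b) (p z).
  have rU' : ball (p y) (r / 2) `<=` U (i, b) by apply: lt_bump_ball; lra.
  apply: rU'; apply: ball_rV => [|j]; first lra.
  rewrite !mxE opprB addrA subrK -mulrBr normrM gtr0_norm//.
  apply: le_lt_trans Nr; rewrite ler_piMr ?(ltW a0)// ler_norml.
  have /andP[zy1 zy2] := yz j.
  have : (y j)%:R <= (z j)%:R :> R by rewrite ler_nat.
  have : (z j)%:R <= (y j)%:R + 1 :> R by rewrite natr1 ler_nat.
  by move=> ? ?; apply/andP; split; lra.
by rewrite /U /=; case: b {rb} => //= ?; apply/negbTE; rewrite -leNgt ltW.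
Qed.

(** * Dimension inequalities *)

Lemma card_short_interval M q (P : pred 'I_M) :
  (forall s t, P s -> P t -> (t < s + q)%N) -> (#|P| <= q)%N.
Proof.
move=> Pq; case: (pickP P) => [s0 Ps0|P0]; last by rewrite eq_card0.
have [s Ps smin] := arg_minnP (fun t : 'I_M => t : nat) Ps0.
rewrite cardE -(size_map val) -(size_iota s q); apply: uniq_leq_size.
  by rewrite map_inj_uniq ?enum_uniq//; exact: val_inj.
move=> _ /mapP[t + ->]; rewrite mem_enum mem_iota => Pt.
by rewrite smin//= Pq.
Qed.

(* Counts the points of a fine grid of the cube that lie in each box. *)
Lemma small_boxes_avoid (R : realType) d (rho : R) N (b : 'I_N -> 'I_d -> R)
    (r : 'I_N -> R) : (0 < d)%N -> 0 < rho -> (forall i, 0 < r i) ->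
  \sum_i r i ^+ d < (rho / 8) ^+ d ->
  exists c : 'I_d -> R, (forall l, 0 < c l < rho) /\
    forall i, exists l, r i < `|b i l - c l|.
Proof.
move=> d0 rho0 r0 rrho.
(* The grid is finer than every box: rho / M is at most 2 r i. Rounding up then costs only a
   constant factor, which the 8 absorbs. *)
pose M := (\sum_i (Num.truncn (rho / (2 * r i))).+1).+1.
have M0 : 0 < M%:R :> R by [].
have rM i : 1 <= 2 * r i * M%:R / rho.
  rewrite ler_pdivlMr// mul1r mulrC -ler_pdivrMr ?mulr_gt0//.
  apply: le_trans (ltW (truncnS_gt _)) _; rewrite ler_nat.
  by rewrite /M (bigD1 i)//= leqW// leq_addr.
(* The shifted numerator and denominator keep the M grid values strictly between 0 and rho. *)
pose c (t : 'I_M) : R := rho * t.+1%:R / M.+1%:R.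
pose q i := (Num.truncn (2 * r i * M.+1%:R / rho)).+1.
have qle i : (q i)%:R <= 8 * r i * M%:R / rho.
  have : (Num.truncn (2 * r i * M.+1%:R / rho))%:R <= 2 * r i * M.+1%:R / rho.
    by rewrite truncn_le// divr_ge0 ?mulr_ge0// ltW.
  have : 2 * r i * M.+1%:R / rho <= 2 * (2 * r i * M%:R / rho).
    have E z : 2 * r i * z / rho = 2 * (r i / rho * z) by ring.
    rewrite !E; have ri : 0 < r i / rho by rewrite divr_gt0.
    have : r i / rho * M.+1%:R <= r i / rho * (2 * M%:R).
      by rewrite ler_pM2l// -natrM ler_nat; lia.
    by move=> ?; lra.
  by have := rM i; rewrite /q -natr1; lra.
pose bad i l : pred 'I_M := [pred t | `|b i l - c t| <= r i].
have card_bad i l : (#|bad i l| <= q i)%N.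
  apply: card_short_interval => s t.
  rewrite -[bad i l s]/(`|_| <= _) -[bad i l t]/(`|_| <= _) => bs bt.
  have : c t - c s <= 2 * r i.
    by move: bs bt; rewrite !ler_norml => /andP[? ?] /andP[? ?]; lra.
  rewrite /c -mulrBl -mulrBr ler_pdivrMr// mulrC -ler_pdivlMr// => ts.
  have := le_lt_trans ts (truncnS_gt _); rewrite -/(q i) ltrBlDl -natrD ltr_nat.
  by rewrite addSn ltnS.
have [h hP] : exists h : {ffun 'I_d -> 'I_M}, forall i, h \notin family (bad i).
  apply: contrapT => /forallNP H.
  have : (#|{ffun 'I_d -> 'I_M}| <= \sum_i #|family (bad i)|)%N.
    under [leqRHS]eq_bigr do rewrite -sum1_card big_mkcond.
    rewrite exchange_big -sum1_card /=; apply: leq_sum => h _.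
    have /existsNP[i /negP] := H h; rewrite negbK => hi.
    by rewrite (bigD1 i)//= hi leq_addr.
  apply/negP; rewrite -ltnNge card_ffun !card_ord -(ltr_nat R) natr_sum.
  apply: (@le_lt_trans _ _ (\sum_i (8 * r i * M%:R / rho) ^+ d)).
    apply: ler_sum => i _; rewrite card_family /image_mem.
    apply: (@le_trans _ _ ((q i ^ d)%:R)); last first.
      by rewrite natrX lerXn2r// ?nnegrE// (le_trans _ (qle i)).
    rewrite ler_nat -[X in (_ <= _ ^ X)%N](card_ord d) [#|'I_d|]cardE.
    elim: (enum 'I_d) => //= l e IH; rewrite expnS leq_mul//.
  have E i : (8 * r i * M%:R / rho) ^+ d = (8 * M%:R / rho) ^+ d * r i ^+ d.
    by rewrite -exprMn; congr (_ ^+ _); ring.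
  rewrite natrX; under eq_bigr do rewrite E.
  have -> : M%:R ^+ d = (8 * M%:R / rho) ^+ d * (rho / 8) ^+ d.
    by rewrite -exprMn; congr (_ ^+ _); field; rewrite gt_eqF.
  by rewrite -mulr_sumr ltr_pM2l// exprn_gt0// divr_gt0// mulr_gt0.
exists (fun l => c (h l)); split=> [l|i].
  rewrite /c divr_gt0 ?mulr_gt0//= ltr_pdivrMr// ltr_pM2l// ltr_nat.
  by rewrite ltnS ltn_ord.
have /familyP H := hP i; apply: contrapT => /forallNP H'; apply: H => l.
by rewrite inE /= leNgt; apply/negP; exact: H'.
Qed.

(* Szpilrajn's inequality: the distances to the faces map K Lipschitz-wise to
   a null set of R^d, which therefore misses a point c of the open cube. *)
Lemma small_covers_inessential (R : realType) (T : pseudoMetricType R) d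
    (K : set T) : (0 < d)%N -> compact K ->
  (forall eta : R, 0 < eta -> exists N (y : 'I_N -> T) (r : 'I_N -> R),
    [/\ forall i, 0 < r i, \sum_i r i ^+ d < eta &
        forall x, K x -> exists i, ball (y i) (r i) x]) ->
  inessential R d K.
Proof.
move=> d0 cK small g cg.
pose A l := [set x | g l x <= -1].
pose B l := K `&` [set x | 1 <= g l x].
have cst0 (z : R) : continuous (fun _ : T => z) by exact: cst_continuous.
have oA l : open (~` A l) by apply: closed_openC; exact: closed_le_fun.
have cB l : compact (B l) by apply: compact_closedI => //; exact: closed_le_fun.
pose phi l := bump (~` A l).
have /choice[rho rhoP] l : exists rho, 0 < rho /\ forall x, B l x -> rho <= phi l x.
  have [||rho rho0 rhoB] := @compact_gt0_bounded _ _ _ (phi l) (cB l).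
  - exact: bump_continuous.
  - by move=> x [_ /= gx]; apply: bump_gt0 => //; rewrite /A /= => ?; lra.
  by exists rho.
pose rh := \big[Num.min/1]_l rho l.
have rh0 : 0 < rh.
  by apply: lt_bigmin => // l _; have [] := rhoP l.
have [|N [y [r [r0 rs yr]]]] := small ((rh / 8) ^+ d).
  by rewrite exprn_gt0// divr_gt0.
have [c [crh cP]] := small_boxes_avoid (fun i l => phi l (y i)) d0 rh0 r0 rs.
exists (fun l x => phi l x - c l); split.
- move=> l; apply: continuous_subr; last exact: cst_continuous.
  exact: bump_continuous.
- move=> l x Kx gx; rewrite subr_gt0.
  have /andP[_ /lt_le_trans] := crh l; apply.
  have [_ /(_ x)] := rhoP l; move=> /(_ (conj Kx gx)); apply: le_trans.
  exact: bigmin_le.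
- move=> l x Kx gx; rewrite subr_lt0 /phi bump_out; last by apply.
  by have /andP[] := crh l.
(* Bumps are 1-Lipschitz, so a common zero x in the i-th ball would put every [phi l (y i)] within
   [r i] of [c l]. *)
- move=> x Kx; have [i yx] := yr _ Kx; have [l] := cP i.
  move=> lc; exists l; apply/eqP => /eqP; rewrite subr_eq0 => /eqP pc.
  move: lc; rewrite -pc ltNge => /negP; apply.
  exact: bump_ball_norm.
Qed.

Lemma compact_nat_cover (T : ptopologicalType) (K : set T) (O : nat -> set T) :
  compact K -> (forall i, open (O i)) -> (forall x, K x -> exists i, O i x) ->
  exists N, forall x, K x -> exists i : 'I_N, O i x.
Proof.
rewrite compact_cover => cK oO KO.
have [||D _ KD] := cK nat setT O; first by [].
  by move=> x /KO[i Oi]; exists i.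
exists (\max_(i <- finmap.enum_fset D) i).+1 => x /KD[i /= iD Oi].
have iN : (i < (\max_(i <- finmap.enum_fset D) i).+1)%N by rewrite ltnS leq_bigmax_seq.
by exists (Ordinal iN).
Qed.

Section diam.
Context {R : realType} {n : nat}.
Implicit Types (U F : set 'rV[R]_n).
Local Open Scope ereal_scope.

Lemma diam_ge0 U : 0 <= diam U.
Proof. by apply: ereal_sup_ubound; left. Qed.

Lemma diam_ge U x y : U x -> U y -> (enorm (x - y))%:E <= diam U.
Proof. by move=> Ux Uy; apply: ereal_sup_ubound; right; exists x => //; exists y. Qed.

Lemma diam_le U (d : R) : (0 <= d)%R ->
  (forall x y, U x -> U y -> enorm (x - y) <= d)%R -> diam U <= d%:E.
Proof.
move=> d0 Ud; apply: ge_ereal_sup => _ [->|[x Ux [y Uy <-]]]; rewrite lee_fin//.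
exact: Ud.
Qed.

Lemma diam0 : diam (set0 : set 'rV[R]_n) = 0.
Proof. by apply/eqP; rewrite eq_le diam_ge0 andbT diam_le. Qed.

Lemma coord_le_enorm (v : 'rV[R]_n) i : (`|v ord0 i| <= enorm v)%R.
Proof.
rewrite -sqrtr_sqr ler_wsqrtr// (bigD1 i)//= lerDl.
by apply: sumr_ge0 => j _; exact: sqr_ge0.
Qed.

End diam.

Section dimT_dimH.
Context {R : realType} {n : nat}.
Implicit Types (K : set 'rV[R]_n).
Local Open Scope ereal_scope.

Lemma gauge_ge (s : R) (d : nat) (U : set 'rV[R]_n) : (s <= d.+1%:R)%R ->
  diam U <= 1 -> ((fine (diam U)) ^+ d.+1)%:E <= hausdorff_gauge s U.
Proof.
move=> sd U1; rewrite /hausdorff_gauge; case: ifPn => [/eqP ->|_].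
  by rewrite diam0/= expr0n.
have U0 := diam_ge0 U.
have -> : diam U = (fine (diam U))%:E.
  by rewrite fineK// ge0_fin_numE// (le_lt_trans U1)// ltry.
rewrite poweR_EFin lee_fin /=.
have : (0 <= fine (diam U) <= 1)%R.
  rewrite fine_ge0//= -lee_fin fineK// ge0_fin_numE//.
  by rewrite (le_lt_trans U1)// ltry.
move: (fine _) => r /andP[]; rewrite le_eqVlt => /predU1P[<- _|r0 r1].
  by rewrite expr0n powR_ge0.
rewrite -powR_mulrn; last exact: ltW.
by apply: ger_powR sd; rewrite r0.
Qed.

(** The sets of a Hausdorff cover are arbitrary and may be single points. Enlarging the i-th one to
    a ball by a summable positive amount [t i] allows compactness to extract finitely many. *)
Lemma hausdorff_null_covers (s : R) (d : nat) K : (s <= d.+1%:R)%R ->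
  hausdorff_measure s K = 0 -> compact K -> forall eta : R, (0 < eta)%R ->
  exists N (y : 'I_N -> 'rV[R]_n) (r : 'I_N -> R),
    [/\ forall i, (0 < r i)%R, (\sum_i r i ^+ d.+1 < eta)%R &
        forall x, K x -> exists i, ball (y i) (r i) x].
Proof.
move=> sd HK cK eta eta0; pose D : R := (2 ^+ d.+1)%R.
have D0 : (0 < D)%R by rewrite exprn_gt0.
(* At scale 1 all diameters are at most 1, so raising the exponent from s to d+1 only lowers the
   sum. *)
have : hausdorff_premeasure s 1 K < (eta / (2 * D))%:E.
  apply: (@le_lt_trans _ _ 0); last by rewrite lte_fin divr_gt0// mulr_gt0.
  by rewrite -HK; apply: ereal_sup_ubound; exists 1%R => //=.
move=> /ereal_inf_lt[_ [U [U1 KU] <-]] Ueta.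
pose del i := fine (diam (U i)).
have del0 i : (0 <= del i)%R by rewrite fine_ge0// diam_ge0.
have diamE i : diam (U i) = (del i)%:E.
  by rewrite fineK// ge0_fin_numE ?diam_ge0// (le_lt_trans (U1 i))// ltry.
(* The bound 1 gives t^(d+1) <= t, and the geometric sum of the [t i] is at most 2 m. The total is
   then below eta / 2 + eta / 4. *)
pose m : R := Num.min 1%R (eta / (8 * D))%R.
have m0 : (0 < m)%R by rewrite lt_min ltr01 divr_gt0// mulr_gt0.
pose t i : R := (m / 2 ^+ i)%R.
have t0 i : (0 < t i)%R by rewrite divr_gt0.
have t1 i : (t i <= 1)%R.
  rewrite ler_pdivrMr// mul1r (@le_trans _ _ 1)%R//; first by rewrite ge_min lexx.
  by rewrite -natrX ler1n expn_gt0.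
have st N : (\sum_(i < N) t i <= eta / (4 * D))%R.
  apply: (@le_trans _ _ (2 * m))%R; last first.
    apply: (@le_trans _ _ (2 * (eta / (8 * D))))%R.
      by rewrite ler_pM2l// ge_min lexx orbT.
    by rewrite le_eqVlt; apply/orP; left; apply/eqP; field; rewrite gt_eqF.
  suff -> : (\sum_(i < N) t i = 2 * m * (1 - (2 ^+ N)^-1))%R.
    by rewrite ler_piMr// ?mulr_ge0 ?(ltW m0)// lerBlDr lerDl invr_ge0 exprn_ge0.
  elim: N => [|N IH]; first by rewrite big_ord0 expr0 invr1 subrr mulr0.
  by rewrite big_ord_recr/= IH /t exprS; field; rewrite expf_neq0.
pose r i := (del i + t i)%R.
have /choice[y yP] i : exists y, U i `<=` ball y (r i).
  have [->|/set0P[y Uy]] := eqVneq (U i) set0; first by exists 0%R.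
  exists y => x Ux; apply: ball_rV => [|l]; first by rewrite /r ltr_wpDl.
  have := coord_le_enorm (y - x) l; rewrite !mxE => /le_lt_trans; apply.
  rewrite /r ltr_pwDr//; have := diam_ge Uy Ux.
  by rewrite diamE lee_fin.
have [||N KN] := @compact_nat_cover _ K (fun i => ball (y i) (r i)) cK.
- by move=> i; exact: ball_open.
- by move=> x /KU[i _ Ui]; exists i; exact: yP.
exists N, (fun i : 'I_N => y i), (fun i : 'I_N => r i); split.
- by move=> i; rewrite /r ltr_wpDl.
- have rD i : (r i ^+ d.+1 <= D * del i ^+ d.+1 + D * t i)%R.
    have [dt|td] := leP (del i) (t i).
      apply: (@le_trans _ _ (D * t i)%R); last first.
        by rewrite lerDr mulr_ge0 ?exprn_ge0// ltW.
      apply: (@le_trans _ _ ((2 * t i) ^+ d.+1))%R.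
        have h : (r i <= 2 * t i)%R by rewrite /r; lra.
        by apply: lerXn2r h; rewrite nnegrE ?mulr_ge0 ?addr_ge0// ltW.
      rewrite exprMn ler_pM2l// exprS ler_piMr ?(ltW (t0 i))//.
      by rewrite exprn_ile1 ?t1// ltW.
    apply: (@le_trans _ _ (D * del i ^+ d.+1)%R); last first.
      by rewrite lerDl mulr_ge0 ?exprn_ge0// ltW.
    have h : (r i <= 2 * del i)%R by rewrite /r; lra.
    rewrite -exprMn; apply: lerXn2r h; rewrite nnegrE ?mulr_ge0// addr_ge0//.
    exact: ltW.
  apply: (@le_lt_trans _ _ (\sum_(i < N) (D * del i ^+ d.+1 + D * t i)))%R.
    by apply: ler_sum => i _; exact: rD.
  rewrite big_split /= -[X in (X + _)%R]mulr_sumr -[X in (_ + X)%R]mulr_sumr.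
  have : (\sum_(i < N) del i ^+ d.+1 < eta / (2 * D))%R.
    rewrite -lte_fin; apply: le_lt_trans Ueta.
    apply: (@le_trans _ _ (\sum_(0 <= i < N) hausdorff_gauge s (U i))).
      rewrite big_mkord -sumEFin; apply: lee_sum => i _; exact: gauge_ge.
    apply: nneseries_lim_ge => i _ _.
    by rewrite /hausdorff_gauge; case: ifP => // _; exact: poweR_ge0.
  move: (st N); rewrite !ler_pdivlMr ?mulr_gt0// !ltr_pdivlMr ?mulr_gt0//.
  by move=> ? ?; lra.
- by [].
Qed.

Lemma dimT_le_dimH K : compact K -> dimT K <= dimH K.
Proof.
(* With d the integer part of s, the exponent d+1 is at least s, so K has no essential map to the
   (d+1)-cube and its dimension is at most d <= s. *)
move=> cK; apply: le_ereal_inf_tmp => _ [s [s0 HK] <-].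
pose d := Num.truncn s; have sd : (s <= d.+1%:R)%R by rewrite ltW// truncnS_gt.
apply: (@le_trans _ _ d%:R%:E); last by rewrite lee_fin truncn_le.
apply/topological_dim_le/covering_dim_le_set_type/(inessential_cdim_le cK).
by apply: small_covers_inessential => // eta; exact: (hausdorff_null_covers sd).
Qed.

End dimT_dimH.

(** * Lower box dimension: economical covers and comparison with the other dimensions *)

Section box_dimension.
Context {R : realType} {n : nat}.
Implicit Types (F : set 'rV[R]_n).
Local Open Scope ereal_scope.

Lemma covered_by_gt0 F d k : F !=set0 -> Defs.covered_by F d k -> (0 < k)%N.
Proof.
move=> [x Fx] [U [_ FU]]; have [i _ _] := FU x Fx.
exact: leq_ltn_trans (ltn_ord i).
Qed.

Lemma covered_by_fin F (d : R) (I : finType) (U : I -> set 'rV[R]_n) :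
  (forall i, open (U i)) -> (forall i, diam (U i) <= d%:E) ->
  (forall x, F x -> exists i, U i x) -> Defs.covered_by F d #|I|.
Proof.
move=> oU dU FU; exists (fun i => U (enum_val i)); split; first by split.
by move=> x /FU[i Uix]; exists (enum_rank i) => //; rewrite enum_rankK.
Qed.

Lemma covering_number_ge1 F d : F !=set0 -> 1 <= covering_number F d.
Proof.
move=> F0; apply: le_ereal_inf_tmp => _ [k Fk <-].
by rewrite lee_fin ler1n; exact: covered_by_gt0 F0 Fk.
Qed.

Lemma covering_number_le F d k : Defs.covered_by F d k ->
  covering_number F d <= k%:R%:E.
Proof. by move=> Fk; apply: ereal_inf_lbound; exists k. Qed.

Local Notation ratio F d := (lne (covering_number F d) / (- ln d)%:E).

Lemma ratio_ge0 F (d : R) : F !=set0 -> (0 < d < 1)%R -> 0 <= ratio F d.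
Proof.
move=> F0 /andP[d0 d1]; apply: mule_ge0.
  by rewrite lne_ge0 covering_number_ge1.
by rewrite inver gt_eqF ?lee_fin ?invr_ge0 ?ltW// oppr_gt0 ln_lt0// d0.
Qed.

Lemma ratio_le F (d s : R) k : F !=set0 -> (0 < d < 1)%R -> Defs.covered_by F d k ->
  (k%:R <= d `^ (- s))%R -> ratio F d <= s%:E.
Proof.
move=> F0 /andP[d0 d1] Fk ks; have ld : (0 < - ln d)%R.
  by rewrite oppr_gt0 ln_lt0// d0.
rewrite inver gt_eqF// lee_pdivrMr//.
have k0 : (0 < k%:R :> R)%R by rewrite ltr0n; exact: covered_by_gt0 F0 Fk.
apply: (@le_trans _ _ (lne k%:R%:E)).
  rewrite lee_lne ?covering_number_le// in_itv/= leey andbT ?lee_fin ?(ltW k0)//.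
  by rewrite (le_trans _ (covering_number_ge1 d F0)).
rewrite lne_EFin// -EFinM lee_fin mulrN -mulNr -ln_powR ler_ln// posrE//.
exact: powR_gt0.
Qed.

Lemma ratio_lt F (d s : R) : (0 < d < 1)%R -> ratio F d < s%:E ->
  F !=set0 -> exists2 k, Defs.covered_by F d k & (k%:R < d `^ (- s))%R.
Proof.
move=> /andP[d0 d1] + F0; have ld : (0 < - ln d)%R.
  by rewrite oppr_gt0 ln_lt0// d0.
rewrite inver gt_eqF// lte_pdivrMr// => cs.
have : covering_number F d < (d `^ (- s))%:E.
  rewrite -lte_lne.
  - by rewrite lne_EFin ?powR_gt0// ln_powR mulNr -mulrN EFinM.
  - by rewrite in_itv/= leey andbT (le_trans _ (covering_number_ge1 d F0)).
  - by rewrite in_itv/= leey andbT lee_fin powR_ge0.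
by move=> /ereal_inf_lt[_ [k Fk <-]]; rewrite lte_fin; exists k.
Qed.

Lemma lower_dimB_ge0 F : F !=set0 -> 0 <= lower_dimB F.
Proof.
move=> F0; rewrite /lower_dimB limf_einfE; apply: le_ereal_sup_tmp.
exists (ereal_inf ((fun d : R => ratio F d) @` [set d | 0 < d < 1]%R)).
  exists [set d | 0 < d < 1]%R => //.
  by near=> d; apply/andP; split; near: d; [exact: nbhs_right_gt|exact: nbhs_right_lt].
by apply: le_ereal_inf_tmp => _ [d /= d01 <-]; exact: ratio_ge0.
Unshelve. all: by end_near. Qed.

(** For a lower limit a single good scale below each d0 suffices; this is what turns an upper bound
    on the dimension into countably many open conditions. *)
Lemma lower_dimB_le F (s : R) : F !=set0 ->
  (forall eta d0, (0 < eta)%R -> (0 < d0)%R -> exists d k,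
     [/\ (0 < d < d0)%R, Defs.covered_by F d k & (k%:R <= d `^ (- (s + eta)))%R]) ->
  lower_dimB F <= s%:E.
Proof.
move=> F0 H; rewrite /lower_dimB limf_einfE; apply: ge_ereal_sup => _ [V nV <-].
apply/lee_addgt0Pr => eta eta0; rewrite -EFinD.
have [e /= e0 eV] : exists2 e : R, (0 < e)%R & forall d, (0 < d < e)%R -> V d.
  case: nV => e /= e0 eV; exists e => // d /andP[d0 de]; apply: eV => //=.
  by rewrite sub0r normrN gtr0_norm.
have [|d [k [/andP[d0 de] Fk ks]]] := H eta (Num.min 1%R e) eta0.
  by rewrite lt_min ltr01.
move: de; rewrite lt_min => /andP[d1 de].
apply: ge_ereal_inf; exists (ratio F d); last first.
  by apply: ratio_le ks => //; rewrite d0.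
by exists d => //; apply: eV; rewrite d0.
Qed.

Lemma lower_dimB_lt F (s : R) : F !=set0 -> lower_dimB F < s%:E ->
  forall d0, (0 < d0)%R -> exists d k,
     [/\ (0 < d < d0)%R, Defs.covered_by F d k & (k%:R < d `^ (- s))%R].
Proof.
move=> F0 Fs d0 d00.
have : ereal_inf ((fun d : R => ratio F d) @` [set d | 0 < d < Num.min 1 d0]%R) < s%:E.
  apply: le_lt_trans Fs; rewrite /lower_dimB limf_einfE.
  apply: ereal_sup_ubound; exists [set d | 0 < d < Num.min 1 d0]%R => //.
  near=> d; apply/andP; split; near: d; first exact: nbhs_right_gt.
  by apply: nbhs_right_lt; rewrite lt_min ltr01.
move=> /ereal_inf_lt[_ [d /= + <-]]; rewrite lt_min => /and3P[dp d1 dd0].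
by move=> /ratio_lt -/(_ _ F0)[|k Fk ks]; rewrite ?dp//; exists d, k; rewrite dp.
Unshelve. all: by end_near. Qed.

Lemma gauge_ge0 s (U : set 'rV[R]_n) : 0 <= hausdorff_gauge s U.
Proof. by rewrite /hausdorff_gauge; case: ifP => // _; exact: poweR_ge0. Qed.

Lemma hausdorff_measure_ge0 s F : 0 <= hausdorff_measure s F.
Proof.
apply: le_ereal_sup_tmp; exists (hausdorff_premeasure s 1 F); first by exists 1%R => /=.
apply: le_ereal_inf_tmp => _ [U _ <-]; apply: nneseries_ge0 => i _ _.
exact: gauge_ge0.
Qed.

Lemma gauge_le (s r : R) (U : set 'rV[R]_n) : (0 <= s)%R -> diam U <= r%:E ->
  hausdorff_gauge s U <= (r `^ s)%:E.
Proof.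
move=> s0 Ur; rewrite /hausdorff_gauge; case: ifP => _.
  by rewrite lee_fin powR_ge0.
rewrite -poweR_EFin; apply: gt0_ler_poweR => //.
  by rewrite in_itv/= leey diam_ge0.
by rewrite in_itv/= leey andbT (le_trans (diam_ge0 U)).
Qed.

Lemma dimH_le_fin F (s : R) : F !=set0 -> lower_dimB F < s%:E -> dimH F <= s%:E.
Proof.
move=> F0 Fs; have s0 : (0 < s)%R.
  by rewrite -lte_fin (le_lt_trans _ Fs)// lower_dimB_ge0.
apply/lee_addgt0Pr => e e0; rewrite -EFinD; apply: ereal_inf_lbound.
exists (s + e)%R => //; split; first by rewrite addr_ge0// ltW.
apply/eqP; rewrite eq_le; apply/andP; split; last exact: hausdorff_measure_ge0.
apply: ge_ereal_sup => _ [d /= d0 <-].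
apply/lee_addgt0Pr => eta eta0; rewrite add0e.
(* Fewer than r^(-s) sets of diameter at most r have (s+e)-sum at most r^e, which is at most eta for
   r below eta^(1/e). *)
pose d1 := Num.min 1%R (Num.min d (eta `^ e^-1)%R).
have [|r [k [/andP[r0 rd1] [U [UP FU]] kr]]] := lower_dimB_lt F0 Fs (d0 := d1).
  by rewrite !lt_min ltr01 d0 powR_gt0.
move: rd1; rewrite !lt_min => /and3P[r1 rd re].
(* The finite cover is continued by empty sets, whose gauge is 0. *)
pose W i := if insub i is Some j then U j else set0.
apply: ge_ereal_inf; exists (\sum_(i <oo) hausdorff_gauge (s + e) (W i)).
  exists W => //; split=> [i|x /FU[j _ Uj]]; last by exists j => //; rewrite /W valK.
  rewrite /W; case: insubP => [j _ _|_]; last by rewrite diam0 lee_fin ltW.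
  by have [_ /le_trans] := UP j; apply; rewrite lee_fin ltW.
have se0 : (0 <= s + e)%R by rewrite addr_ge0// ltW.
rewrite (nneseries_split 0 k); last by move=> i _; exact: gauge_ge0.
rewrite add0n [X in _ + X]eseries0 => [|i ki _]; last first.
  by rewrite /W insubF ?/hausdorff_gauge ?eqxx// ltnNge ki.
rewrite adde0; apply: (@le_trans _ _ (\sum_(0 <= i < k) (r `^ (s + e))%:E)).
  apply: lee_sum => i _; apply: gauge_le => //.
  rewrite /W; case: insubP => [j _ _|_]; last by rewrite diam0 lee_fin ltW.
  by have [] := UP j.
rewrite sumEFin lee_fin sumr_const_nat subn0 -mulr_natr.
apply: (@le_trans _ _ (r `^ (s + e) * r `^ (- s)))%R.
  by rewrite ler_wpM2l ?powR_ge0// ltW.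
have rne : r != 0%R by rewrite gt_eqF.
rewrite -powRD ?rne ?implybT// addrAC subrr add0r.
apply: (@le_trans _ _ ((eta `^ e^-1) `^ e))%R.
  apply: ge0_ler_powR; rewrite ?nnegrE ?powR_ge0//; exact: ltW.
rewrite -powRrM mulVf; last by rewrite gt_eqF.
by rewrite powRr1// ltW.
Qed.

Lemma dimH_le_lower_dimB F : F !=set0 -> dimH F <= lower_dimB F.
Proof.
move=> F0; have B0 := lower_dimB_ge0 F0.
move BE : (lower_dimB F) B0 => [b| |]// B0; last by rewrite leey.
apply/lee_addgt0Pr => e e0; rewrite -EFinD; apply: dimH_le_fin => //.
by rewrite BE lte_fin ltrDl.
Qed.

(** Balls refer to the maximum norm and [diam] to the Euclidean one, whence the factor sqrt n; the
    added 1 makes it positive even for n = 0. *)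
Lemma diam_ball_le (z : 'rV[R]_n) (r : R) : (0 <= r)%R ->
  diam (ball z r) <= ((Num.sqrt n%:R + 1) * (2 * r))%:E.
Proof.
move=> r0; apply: diam_le => [|x y].
  by rewrite mulr_ge0 ?addr_ge0 ?sqrtr_ge0 ?mulr_ge0.
rewrite mx_norm_ball /ball_ /= => zx zy.
apply: le_trans (enorm_le_norm _) _; apply: ler_pM => //.
  by rewrite lerDl.
have -> : (x - y = (z - y) - (z - x))%R by rewrite opprB [RHS]addrC addrA subrK.
by apply: le_trans (ler_normB _ _) _; move: (ltW zx) (ltW zy); lra.
Qed.

(** F lies in finitely many affine images of the unit k-cube. Rounding the parameters down to
    multiples of 1/N gives of order N^k balls of diameter of order 1/N. *)
Lemma affine_image_covers F k (I : finType) (b : I -> 'rV[R]_n)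
    (w : I -> 'I_k -> 'rV[R]_n) :
  (forall x, F x -> exists i (mu : 'I_k -> R),
     (forall l, 0 <= mu l <= 1)%R /\ x = (b i + \sum_l mu l *: w i l)%R) ->
  forall eta d0, (0 < eta)%R -> (0 < d0)%R -> exists d N,
     [/\ (0 < d < d0)%R, Defs.covered_by F d N &
         (N%:R <= d `^ (- (k%:R + eta)))%R].
Proof.
move=> Fw eta d0 eta0 d00.
pose W : R := (1 + \sum_i \sum_l `|w i l|)%R.
have wW i : (\sum_l `|w i l| <= W)%R.
  rewrite /W (bigD1 i)//= addrCA lerDl addr_ge0// sumr_ge0// => j _.
  by apply: sumr_ge0.
have W0 : (0 < W)%R.
  by rewrite ltr_pwDl// sumr_ge0// => i _; exact: sumr_ge0.
pose c : R := ((Num.sqrt n%:R + 1) * (2 * (2 * W)))%R.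
have c0 : (0 < c)%R by rewrite !mulr_gt0// ltr_wpDl// sqrtr_ge0.
pose C : R := (#|I|%:R * (2 * c) ^+ k + 1)%R.
have C0 : (0 < C)%R by rewrite ltr_wpDl// mulr_ge0// exprn_ge0// mulr_ge0// ltW.
(* Below C^(-1/eta) the extra factor d^(-eta) exceeds the constant C of the count C d^(-k). *)
pose e : R := Num.min d0 (C `^ (- eta^-1))%R.
have e0 : (0 < e)%R by rewrite lt_min d00 powR_gt0.
pose N := (Num.truncn (c / e)).+1.
have N0 : (0 < N%:R :> R)%R by [].
pose d : R := (c / N%:R)%R.
have d_gt0 : (0 < d)%R by rewrite divr_gt0.
have de : (d < e)%R.
  by rewrite ltr_pdivrMr// mulrC -ltr_pdivrMr// truncnS_gt.
pose z (p : I * {ffun 'I_k -> 'I_N.+1}) :=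
  (b p.1 + \sum_l (p.2 l)%:R / N%:R *: w p.1 l)%R.
exists d, #|{: I * {ffun 'I_k -> 'I_N.+1}}|; split.
- by rewrite d_gt0 (lt_le_trans de)// ge_min lexx.
- apply: (@covered_by_fin _ _ _ (fun p => ball (z p) (2 * W / N%:R)%R)).
  + by move=> p; exact: ball_open.
  + move=> p; apply: le_trans (diam_ball_le _ _) _.
      by rewrite divr_ge0// mulr_ge0// ltW.
    by rewrite lee_fin /d /c !mulrA.
  + move=> x /Fw[i [mu [mu01 ->]]].
    have muN l : (Num.truncn (mu l * N%:R) < N.+1)%N.
      have /andP[mu0 mu1] := mu01 l.
      rewrite ltnS -(ler_nat R) (@le_trans _ _ (mu l * N%:R)%R)//.
        by rewrite truncn_le mulr_ge0.
      by rewrite ler_piMl.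
    exists (i, [ffun l => Ordinal (muN l)]).
    rewrite mx_norm_ball /ball_ /= /z /= opprD addrACA subrr add0r -sumrB.
    apply: le_lt_trans (ler_norm_sum _ _ _) _.
    apply: (@le_lt_trans _ _ (\sum_l N%:R^-1 * `|w i l|))%R.
      apply: ler_sum => l _; rewrite ffunE /= -scalerBl normrZ distrC ler_wpM2r//.
      have /andP[mu0 _] := mu01 l.
      have tmu : (0 <= mu l * N%:R)%R by rewrite mulr_ge0.
      have /andP[t1 t2] := truncn_itv tmu.
      rewrite -[leRHS]div1r ler_pdivlMr// -[X in (_ * X)%R](ger0_norm (ltW N0)).
      rewrite -normrM mulrBl divfK ?gt_eqF// ger0_norm ?subr_ge0//.
      by move: t2; rewrite -natr1; lra.
    rewrite -mulr_sumr mulrC ltr_pdivlMr// divfK ?gt_eqF//.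
    by apply: le_lt_trans (wW i) _; lra.
rewrite card_prod card_ffun !card_ord natrM natrX.
have dk : (d `^ (- (k%:R + eta)) = (d `^ eta)^-1 * (d ^+ k)^-1)%R.
  rewrite powRN powRD ?(gt_eqF d_gt0) ?implybT// powR_mulrn ?ltW//.
  by rewrite invfM mulrC.
have Ceta : (C <= (d `^ eta)^-1)%R.
  rewrite -[leLHS]invrK lef_pV2 ?posrE ?invr_gt0 ?powR_gt0//.
  have -> : (C^-1 = (C `^ (- eta^-1)) `^ eta)%R.
    by rewrite -powRrM mulNr mulVf ?gt_eqF// powR_inv1// ltW.
  apply: ge0_ler_powR; rewrite ?nnegrE ?powR_ge0 ?(ltW d_gt0) ?(ltW eta0)//.
  by rewrite (le_trans (ltW de))// ge_min lexx orbT.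
have N2 : (N.+1%:R <= 2 * c * d^-1)%R.
  have -> : (2 * c * d^-1 = 2 * N%:R)%R.
    by rewrite /d; field; rewrite (gt_eqF c0) (gt_eqF N0).
  by rewrite -natrM ler_nat; lia.
rewrite dk; apply: (@le_trans _ _ (C * (d ^+ k)^-1))%R; last first.
  by rewrite ler_wpM2r// invr_ge0 exprn_ge0// ltW.
apply: (@le_trans _ _ (#|I|%:R * (2 * c * d^-1) ^+ k))%R.
  rewrite ler_wpM2l//; apply: lerXn2r N2; rewrite nnegrE//.
  by rewrite mulr_ge0 ?invr_ge0 ?(ltW d_gt0)// mulr_ge0// ltW.
rewrite exprMn exprVn mulrA ler_wpM2r ?invr_ge0 ?exprn_ge0 ?(ltW d_gt0)//.
by rewrite lerDl.
Qed.

Lemma lower_dimB_le_n F : F !=set0 -> bounded_set F -> lower_dimB F <= n%:R%:E.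
Proof.
move=> F0 [M0 [_ FM0]].
have [M [M_gt0 FM]] : exists M : R, (0 < M)%R /\ forall x, F x -> (`|x| <= M)%R.
  exists (Num.max 1 (M0 + 1))%R; split; first by rewrite lt_max ltr01.
  by move=> x Fx; apply: FM0 => //; rewrite lt_max ltrDl ltr01 orbT.
apply: lower_dimB_le => //.
(* The cube [-M, M]^n is one affine image of the unit n-cube, with corner -M and edges of length 2
   M. *)
apply: (@affine_image_covers _ n unit (fun=> \row_i (- M))%R
  (fun _ l => (2 * M) *: delta_mx ord0 l)%R) => x Fx.
exists tt, (fun l => (x ord0 l + M) / (2 * M))%R; split=> [l|].
  have xl : (`|x ord0 l| <= M)%R.
    apply: le_trans (FM _ Fx); rewrite [leRHS]/Num.norm/= mx_normrE.
    exact: (le_bigmax _ (fun ij => `|x ij.1 ij.2|%R) (ord0, l)).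
  move: xl; rewrite ler_norml => /andP[? ?].
  have M2 : (0 < 2 * M)%R by rewrite mulr_gt0.
  apply/andP; split; first by apply: divr_ge0; lra.
  by rewrite ler_pdivrMr//; lra.
apply/rowP => l; rewrite !mxE summxE (bigD1 l)//= big1 => [|j jl]; last first.
  by rewrite !mxE eqxx eq_sym (negbTE jl)/= !mulr0.
rewrite !mxE !eqxx /= mulr1 addr0 divfK ?gt_eqF ?mulr_gt0//.
by rewrite addrC addrK.
Qed.

End box_dimension.

(** * Cantor schemes *)

Lemma countable_setU (T : Type) (A B : set T) :
  countable A -> countable B -> countable (A `|` B).
Proof. by move=> cA cB; rewrite -bigcup2E; apply: bigcup_countable => // -[|[|]]. Qed.

(** The sets whose complement in K is countable form a proper filter, and a cluster point of this
    filter is a condensation point. *)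
Lemma condensation_point (T : topologicalType) (K : set T) :
  compact K -> ~ countable K ->
  exists2 x, K x & forall U, nbhs x U -> ~ countable (K `&` U).
Proof.
move=> cK nK; pose F : set_system T := [set A | countable (K `\` A)].
have FF : ProperFilter F.
  apply: Build_ProperFilter_ex.
    move=> A FA; apply: contrapT => A0; apply: nK; apply: sub_countable FA.
    by apply: subset_card_le => x Kx; split => // Ax; apply: A0; exists x.
  split.
  - by rewrite /F /= setDT; exact: countable0.
  - by move=> A B FA FB; rewrite /F /= setDIr; exact: countable_setU.
  - move=> A B AB; apply: sub_countable; apply: subset_card_le.
    by move=> x [Kx nB]; split => // /AB.
have FK : F K by rewrite /F /= setDv; exact: countable0.
have [x [Kx xF]] := cK F FF FK; exists x => // U xU cU.
have FU : F (~` U) by rewrite /F /= setDE setCK.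
by have [y [nUy Uy]] := xF _ _ FU xU.
Qed.

(** Around a condensation point x, the set K without x is a countable union of complements of small
    balls, so one of these is uncountable. Two levels of the bump of that ball separate this
    complement from a neighbourhood of x, which is uncountable too. *)
Lemma uncountable_split (R : realType) (X : metricType R) (K : set X) :
  compact K -> ~ countable K -> exists L : bool -> set X,
    (forall b, [/\ compact (L b), L b `<=` K & ~ countable (L b)]) /\
    L false `&` L true = set0.
Proof.
move=> cK nK; have [x Kx xU] := condensation_point cK nK.
have [j nj] : exists j : nat, ~ countable (K `\` (interior (ball x (j.+1%:R^-1 : R)))).
  apply: contrapT => /forallNP H; apply: nK.
  have : countable ([set x] `|` \bigcup_j (K `\` interior (ball x (j.+1%:R^-1 : R)))).
    apply: countable_setU => //; apply: bigcup_countable => // j _.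
    exact: contrapT (H j).
  apply: sub_countable; apply: subset_card_le => y Ky.
  have [->|xy] := eqVneq x y; [by left|right].
  have d0 : 0 < mdist x y by rewrite mdist_gt0.
  exists (Num.truncn (mdist x y)^-1) => //; split => // /interior_subset.
  rewrite ballEmdist /= => xyj.
  have : (Num.truncn (mdist x y)^-1).+1%:R^-1 < mdist x y.
    by rewrite -[ltRHS]invrK ltf_pV2 ?posrE ?invr_gt0// truncnS_gt.
  by move=> /(lt_trans xyj); rewrite ltxx.
pose U := interior (ball x (j.+1%:R^-1 : R)).
have bx : 0 < bump U x.
  by apply: bump_gt0; [exact: open_interior|apply: nbhsx_ballx; rewrite invr_gt0].
have cb (c : R) : continuous (fun _ : X => c) by exact: cst_continuous.
exists (fun b => K `&` if b then [set y | bump U y <= 0]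
                 else [set y | bump U x / 2 <= bump U y]); split.
  move=> b; split.
  - apply: compact_closedI => //.
    by case: b; apply: closed_le_fun => //; exact: bump_continuous.
  - by move=> y [].
  - case: b.
      apply: contra_not nj; apply: sub_countable; apply: subset_card_le => y.
      by move=> [Ky nUy]; split => //=; rewrite bump_out.
    apply: contra_not (xU [set y | bump U x / 2 < bump U y] _).
      apply: sub_countable; apply: subset_card_le => y [Ky /= /ltW]//.
    apply: open_nbhs_nbhs; split; last by rewrite /=; lra.
    by apply: open_lt_fun => //; exact: bump_continuous.
by apply/seteqP; split => // y [[_ /= y1] [_ /= y2]]; exfalso; lra.
Qed.

(** Repeated splitting gives a binary tree of disjoint uncountable compact sets, and [w j] reads off
    the j-th branch taken. As a quotient of bumps it is continuous on the whole of X, not only on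
    the Cantor set. *)
Lemma cantor_scheme (R : realType) (X : metricType R) (K : set X) :
  compact K -> ~ countable K -> exists w : nat -> X -> R,
    [/\ forall j, continuous (w j), forall j x, 0 <= w j x <= 1 &
     forall s : nat -> bool, exists2 x, K x & forall j, w j x = (s j)%:R].
Proof.
move=> cK nK; pose good (K' : set X) := compact K' /\ ~ countable K'.
have /choice[sp spP] (K' : set X) : exists L : bool -> set X, good K' ->
    (forall b, good (L b) /\ L b `<=` K') /\ L false `&` L true = set0.
  have [[cK' nK']|ng] := pselect (good K'); last by exists (fun=> set0).
  have [L [LP L0]] := uncountable_split cK' nK'.
  by exists L => _; split => // b; have [] := LP b.
(* The head of the list is the latest choice, so that [T (b :: s)] is a half of [T s]; hence the
   [rev] in [sq] below. *)
pose T := foldr (fun b K' => sp K' b) K.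
have goodT s : good (T s).
  by elim: s => //= b s IH; have [/(_ b)[]] := spP _ IH.
have subT b s : T (b :: s) `<=` T s.
  by have [/(_ b)[]] := spP _ (goodT s).
have disjT s t : size s = size t -> s <> t -> T s `&` T t = set0.
  elim: s t => [|b s IH] [|c t]// [st] bc; apply/seteqP; split => // x [Tx Tx'].
  have [st'|st'] := pselect (s = t); last first.
    by rewrite -(IH t st st'); split; [exact: subT Tx|exact: subT Tx'].
  have [_ <-] := spP _ (goodT s).
  rewrite -st' in bc Tx'.
  by case: b c bc Tx Tx' => [] [].
pose A j b := \bigcup_(s in [set` enum {: j.-tuple bool}]) T (b :: s).
have closedT s : closed (T s).
  apply: compact_closed; last by have [] := goodT s.
  exact: metric_hausdorff.
have cA j b : closed (A j b).
  by apply: closed_bigcup => // s _; exact: closedT.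
have A0 j x : A j false x -> ~ A j true x.
  move=> [s _ Tx] [t _ Tx']; suff : set0 x by [].
  rewrite -(disjT (false :: s) (true :: t)) /= ?size_tuple//.
pose p j b := bump (~` A j b).
have oA j b : open (~` A j b) by exact: closed_openC.
have p0 j b x : 0 <= p j b x by exact: bump_ge0.
have pA j b x : A j b x -> p j b x = 0.
  by move=> Ax; apply: bump_out; apply.
have pnA j b x : ~ A j b x -> 0 < p j b x.
  by move=> Ax; apply: bump_gt0.
have pp j x : 0 < p j false x + p j true x.
  have [Ax|Ax] := pselect (A j false x).
    by rewrite ltr_wpDl// pnA//; exact: A0.
  by rewrite ltr_pwDl// pnA.
exists (fun j x => p j false x / (p j false x + p j true x)); split.
- move=> j; apply: continuous_mulr; first exact: bump_continuous.
  move=> x; apply: cvgV; first by rewrite gt_eqF.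
  by apply: continuous_addr; exact: bump_continuous.
- move=> j x; rewrite divr_ge0 ?(ltW (pp _ _))//= ler_pdivrMr// mul1r.
  by rewrite lerDl.
move=> s; pose sq j := rev (mkseq s j).
have sqS j : sq j.+1 = s j :: sq j by rewrite /sq mkseqS rev_rcons.
(* A cluster point of the filter of the decreasing pieces lies in all of them, since they are
   closed. *)
pose F : set_system X := [set B | exists j, T (sq j) `<=` B].
have Tmono i j : (i <= j)%N -> T (sq j) `<=` T (sq i).
  elim: j => [|j IH]; first by rewrite leqn0 => /eqP ->.
  rewrite leq_eqVlt => /predU1P[->//|]; rewrite ltnS => /IH.
  by apply: subset_trans; rewrite sqS; exact: subT.
have FF : ProperFilter F.
  apply: Build_ProperFilter_ex.
    move=> B [j TB]; have [_ nT] := goodT (sq j).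
    apply: contrapT => B0; apply: nT.
    have -> : T (sq j) = set0; last exact: countable0.
    by apply/seteqP; split => // x /TB Bx; apply: B0; exists x.
  split.
  - by exists 0%N.
  - move=> B C [i TB] [j TC]; exists (maxn i j) => x Tx; split.
      by apply/TB/(Tmono _ _ (leq_maxl i j)).
    by apply/TC/(Tmono _ _ (leq_maxr i j)).
  - by move=> B C BC [j TB]; exists j; exact: subset_trans TB BC.
have [|x [Kx xF]] := cK F FF; first by exists 0%N.
have Tx j : T (sq j) x.
  apply: closedT => U xU.
  have [y [Ty Uy]] := xF (T (sq j)) U (ex_intro _ j (@subset_refl _ _)) xU.
  by exists y.
exists x => // j.
have Ax : A j (s j) x.
  have sz : size (sq j) == j by rewrite size_rev size_mkseq.
  exists (Tuple sz); first by rewrite /= mem_enum.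
  by have := Tx j.+1; rewrite sqS.
case: (s j) Ax => Ax; last by rewrite pA// mul0r.
by have := pp j x; rewrite (pA _ _ _ Ax) addr0 => pf; rewrite divff// gt_eqF.
Qed.

Section binary_series.
Context {R : realType} {X : topologicalType}.
Variable v : nat -> X -> R.
Hypothesis v01 : forall j x, 0 <= v j x <= 1.

Definition binary_psum N x := \sum_(j < N) v j x / 2 ^+ j.+1.

Definition binary_sum x := sup [set binary_psum N x | N in [set: nat]].

Lemma binary_psumS N x :
  binary_psum N.+1 x = binary_psum N x + v N x / 2 ^+ N.+1.
Proof. exact: big_ord_recr. Qed.

Lemma binary_psum_le N M x : binary_psum (N + M) x <= binary_psum N x + (2 ^+ N)^-1.
Proof.
(* Subtracting the remaining tail makes the induction on M close. *)
suff : binary_psum (N + M) x <= binary_psum N x + (2 ^+ N)^-1 - (2 ^+ (N + M))^-1.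
  move=> /le_trans; apply; rewrite gerBl invr_ge0.
  exact: exprn_ge0.
elim: M => [|M IH]; first by rewrite addn0 addrK.
rewrite addnS binary_psumS.
have /andP[_ v1] := v01 (N + M) x.
have p0 : 0 < (2 ^+ (N + M).+1)^-1 :> R by rewrite invr_gt0 exprn_gt0.
have := ler_wpM2r (ltW p0) v1; rewrite mul1r => vN.
move: IH; have -> : (2 ^+ (N + M))^-1 = 2 * (2 ^+ (N + M).+1)^-1 :> R.
  by rewrite exprS invfM mulVKf.
lra.
Qed.

Lemma binary_psum_homo N M x : (N <= M)%N -> binary_psum N x <= binary_psum M x.
Proof.
move=> /subnKC <-; elim: (M - N)%N => [|k IH]; first by rewrite addn0.
apply: le_trans IH _; rewrite addnS binary_psumS lerDl.
by have /andP[v0 _] := v01 (N + k) x; rewrite divr_ge0// exprn_ge0.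
Qed.

Lemma binary_sum_itv N x :
  binary_psum N x <= binary_sum x <= binary_psum N x + (2 ^+ N)^-1.
Proof.
have ub : ubound [set binary_psum M x | M in [set: nat]]
    (binary_psum N x + (2 ^+ N)^-1).
  move=> _ [M _ <-]; have [NM|MN] := leqP N M.
    by rewrite -(subnKC NM) binary_psum_le.
  by rewrite (le_trans (binary_psum_homo x (ltnW MN)))// lerDl invr_ge0 exprn_ge0.
apply/andP; split; last by apply: ge_sup => //; exists (binary_psum 0 x), 0%N.
by apply: ub_le_sup; [exists (binary_psum N x + (2 ^+ N)^-1)|exists N].
Qed.

Lemma binary_sum01 x : 0 <= binary_sum x <= 1.
Proof.
by have := binary_sum_itv 0 x; rewrite /binary_psum big_ord0 add0r expr0 invr1.
Qed.

Lemma half_exp_lt (e : R) : 0 < e -> exists N, (2 ^+ N)^-1 < e.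
Proof.
move=> e0; exists (Num.truncn e^-1).+1.
rewrite -[ltRHS]invrK ltf_pV2 ?posrE ?invr_gt0 ?exprn_gt0//.
apply: lt_le_trans (truncnS_gt _) _.
by rewrite -natrX ler_nat ltnW// ltn_expl.
Qed.

Lemma binary_sum_continuous : (forall j, continuous (v j)) ->
  continuous binary_sum.
Proof.
move=> cv x; apply/cvgrPdist_lt => e e0.
have [N Ne] : exists N, (2 ^+ N)^-1 < e / 2 by apply: half_exp_lt; rewrite divr_gt0.
have cp : continuous (binary_psum N).
  apply: continuous_sumr => j; apply: continuous_mulr; first exact: cv.
  exact: cst_continuous.
have e2 : 0 < e / 2 by rewrite divr_gt0.
have /cvgrPdist_lt/(_ _ e2) := cp x.
apply: filterS => y; have := binary_sum_itv N x; have := binary_sum_itv N y.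
rewrite !ltr_norml => /andP[y1 y2] /andP[x1 x2] /andP[xy1 xy2].
by apply/andP; split; lra.
Qed.

End binary_series.

(** The digits come from iterating the doubling map. A tie gives the digit 1, and the remainder 1 is
    allowed, so y = 1 has all digits 1. *)
Lemma binary_digits (R : realType) (y : R) : 0 <= y <= 1 ->
  exists s : nat -> bool, forall N,
    \sum_(j < N) (s j)%:R / 2 ^+ j.+1 <= y
      <= \sum_(j < N) (s j)%:R / 2 ^+ j.+1 + (2 ^+ N)^-1.
Proof.
move=> y01; pose bit (r : R) : bool := 1 <= 2 * r; pose step r := 2 * r - (bit r)%:R.
pose r j := iter j step y; pose s j := bit (r j).
have r01 j : 0 <= r j <= 1.
  elim: j => //= j; rewrite /step -/(r j) /bit => /andP[? ?].
  by case: (leP 1 (2 * r j)) => /= ?; apply/andP; split; lra.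
have yr N : y = \sum_(j < N) (s j)%:R / 2 ^+ j.+1 + r N / 2 ^+ N.
  elim: N => [|N IH]; first by rewrite big_ord0 add0r expr0 divr1.
  rewrite big_ord_recr /= -[in RHS]addrA -mulrDl -/(r N) /step -/(s N).
  rewrite addrCA subrr addr0 exprS -mulf_div divff// mul1r.
  exact: IH.
exists s => N; have /andP[r0 r1] := r01 N.
have p0 : 0 <= (2 ^+ N)^-1 :> R by rewrite invr_ge0 exprn_ge0.
have : r N / 2 ^+ N <= (2 ^+ N)^-1 by rewrite ler_piMl.
have : 0 <= r N / 2 ^+ N by rewrite mulr_ge0.
by have := yr N => ? ? ?; apply/andP; split; lra.
Qed.

(** The bits read by the Cantor scheme are dealt out to the n coordinates by residues modulo n, and
    each coordinate sums its own bits as a binary expansion. *)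
Lemma cube_image (R : realType) (X : metricType R) (K : set X) n :
  compact K -> ~ countable K -> exists u : 'I_n -> X -> R,
    [/\ forall i, continuous (u i), forall i x, 0 <= u i x <= 1 &
     forall y : 'I_n -> R, (forall i, 0 <= y i <= 1) ->
       exists2 x, K x & forall i, u i x = y i].
Proof.
move=> cK nK; have [w [cw w01 wK]] := cantor_scheme cK nK.
pose v (i : 'I_n) j := w (j * n + i)%N.
exists (fun i => binary_sum (v i)); split.
- by move=> i; apply: binary_sum_continuous => j *; [exact: w01|exact: cw].
- by move=> i x; apply: binary_sum01 => *; exact: w01.
move=> y y01; have /choice[s sP] i := binary_digits (y01 i).
pose t k := if insub (k %% n)%N is Some i then s i (k %/ n)%N else false.
have tE (i : 'I_n) j : t (j * n + i)%N = s i j.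
  rewrite /t modnMDl modn_small// valK divnMDl ?divn_small ?addn0//.
  exact: leq_ltn_trans (ltn_ord i).
have [x Kx xt] := wK t; exists x => // i.
have xN N : binary_psum (v i) N x = \sum_(j < N) (s i j)%:R / 2 ^+ j.+1.
  by apply: eq_bigr => j _; rewrite /v xt tE.
apply/eqP; rewrite -subr_eq0 -normr_le0; apply/ler_addgt0Pr => e e0.
have [N Ne] := half_exp_lt e0; rewrite add0r (le_trans _ (ltW Ne))//.
have := @binary_sum_itv _ _ (v i) (fun j x => w01 _ x) N x.
have := sP i N; rewrite xN ler_norml => /andP[? ?] /andP[? ?].
by apply/andP; split; lra.
Qed.

(** * Spaces of continuous maps *)

Lemma compact_ball_net (R : realType) n (K : set 'rV[R]_n) (e : R) : 0 < e ->
  compact K -> exists N (c : 'I_N -> 'rV[R]_n),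
    forall y, K y -> exists i, ball (c i) e y.
Proof.
move=> e0; rewrite compact_cover => cK.
have [||D _ KD] := cK _ setT (fun y => ball y e).
- by move=> y _; exact: ball_open.
- by move=> y Ky; exists y => //; exact: ballxx.
pose s := finmap.enum_fset D.
exists (size s), (fun i => nth 0 s i) => y /KD[z /= zD zy].
have zs : (index z s < size s)%N by rewrite index_mem.
by exists (Ordinal zs); rewrite /= nth_index.
Qed.

Lemma nowhere_dense_sub (T : topologicalType) (A B : set T) :
  A `<=` B -> nowhere_dense B -> nowhere_dense A.
Proof.
move=> AB; rewrite /nowhere_dense => B0; apply/seteqP; split => //.
by rewrite -B0; apply: interiorS; exact: closureS.
Qed.

Lemma nowhere_dense0 (T : topologicalType) : nowhere_dense (set0 : set T).
Proof. by rewrite /nowhere_dense closure0 interior0. Qed.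

(** [meagre] asks for equality with a union, so the covering sets are intersected with S. *)
Lemma meagre_sub (T : topologicalType) (S A : set T) (F : nat -> set T) :
  nowhere_dense A -> (forall i, nowhere_dense (F i)) ->
  S `<=` A `|` \bigcup_i F i -> meagre S.
Proof.
move=> nA nF SAF.
exists (fun i => S `&` if i is j.+1 then F j else A); split.
  by move=> [|i]; apply: nowhere_dense_sub (@subIsetr _ S _) _.
apply/seteqP; split => [x Sx|x [i _ []]//].
by have [Ax|[i _ Fx]] := SAF _ Sx; [exists 0%N|exists i.+1].
Qed.

Section Cn_perturbation.
Context {R : realType} (X : metricType R) (cptX : compact [set: X]) (n : nat).
Implicit Types (f g : Cn cptX n) (c : 'rV[R]_n).

Lemma CnP f : continuous f. Proof. by have /asboolP := Cn_continuous f. Qed.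

Lemma Cn_coord_continuous f i : continuous (fun x => f x ord0 i).
Proof. exact: continuous_coord (@CnP f). Qed.

Lemma compact_range f : compact (range f).
Proof. by apply: continuous_compact => //; exact: continuous_subspaceT (@CnP f). Qed.

Lemma Cn_coord_dist f g (e : R) : ball f e g ->
  forall x i, `|f x ord0 i - g x ord0 i| < e.
Proof.
rewrite -ball_normE /= => fg x i; apply: le_lt_trans fg.
have := coord_le_enorm ((f - g) x) i; rewrite !mxE => /le_trans; apply.
exact: (enorm_le_supnorm (f - g)).
Qed.

Lemma rV_norm_le (v : 'rV[R]_n) (e : R) : 0 <= e ->
  (forall i, `|v ord0 i| <= e) -> `|v| <= e.
Proof.
move=> e0 ve; rewrite [leLHS]/Num.norm/= mx_normrE.
by apply: bigmax_le => //= -[i j] _ /=; rewrite ord1.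
Qed.

Lemma Cn_ball f g (e e' : R) : 0 <= e' -> (Num.sqrt n%:R + 1) * e' < e ->
  (forall x i, `|f x ord0 i - g x ord0 i| <= e') -> ball f e g.
Proof.
move=> e'0 ee' fg; rewrite -ball_normE /=; apply: le_lt_trans ee'.
apply: supnorm_le => [|x]; first by rewrite mulr_ge0// addr_ge0// sqrtr_ge0.
apply: le_trans (enorm_le_norm _) _; apply: ler_pM => //.
  by rewrite lerDl.
by apply: rV_norm_le => // i; have := fg x i; rewrite !mxE.
Qed.

Lemma Cn_of_coords (u : 'I_n -> X -> R) : (forall i, continuous (u i)) ->
  exists f : Cn cptX n, forall x i, f x ord0 i = u i x.
Proof.
move=> cu; have cf : (fun x => \row_i u i x) \in @continuous_map R X n.
  by apply/asboolP; exact: continuous_rV.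
by exists (MkCn cptX cf) => x i; rewrite mxE.
Qed.

(* Clamping c + e u - f makes an extension theorem unnecessary. *)
Lemma Cn_plant f c (e : R) (u : 'I_n -> X -> R) : 0 < e ->
  (forall i, continuous (u i)) -> (forall i x, `|u i x| <= 1) ->
  exists F : Cn cptX n, (forall x i, `|f x ord0 i - F x ord0 i| <= 2 * e) /\
    forall x, (forall i, `|f x ord0 i - c ord0 i| <= e) ->
    forall i, F x ord0 i = c ord0 i + e * u i x.
Proof.
move=> e0 cu u1; have cst0 (a : R) : continuous (fun _ : X => a).
  exact: cst_continuous.
pose d i x := c ord0 i + e * u i x - f x ord0 i.
(* Where f is within e of c, the correction is at most e + e in size, so clamping at 2 e leaves it
   unchanged. *)
have [i|F FE] := @Cn_of_coords (fun i x => f x ord0 i +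
    Num.max (- (2 * e)) (Num.min (2 * e) (d i x))).
  apply: continuous_addr; first exact: Cn_coord_continuous.
  apply: continuous_maxr => //; apply: continuous_minr => //.
  apply: continuous_subr; last exact: Cn_coord_continuous.
  by apply: continuous_addr => //; exact: continuous_mulr.
exists F; split=> [x i|x fc i].
  rewrite FE opprD addrA subrr add0r normrN ler_norml.
  by rewrite le_max lexx ge_max ge_min lexx/= andbT; lra.
have := fc i; have := u1 i x; rewrite !ler_norml => /andP[u2 u3] /andP[f1 f2].
have eu1 : e * u i x <= e by rewrite ler_piMr// ltW.
have eu2 : - e <= e * u i x by rewrite -mulrN1 ler_pM2l.
rewrite FE min_r; last by rewrite /d; lra.
by rewrite max_r /d; lra.
Qed.

Definition near_cell f c (e : R) := [set x | forall i, `|f x ord0 i - c ord0 i| <= e].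

Lemma closed_near_cell f c e : closed (near_cell f c e).
Proof.
have -> : near_cell f c e =
    \bigcap_i [set x | `|f x ord0 i - c ord0 i| <= e].
  by apply/seteqP; split => x H i *; exact: H.
apply: closed_bigI => i _; apply: closed_le_fun; last exact: cst_continuous.
apply: continuous_normr; apply: continuous_subr; last exact: cst_continuous.
exact: Cn_coord_continuous.
Qed.

Lemma compact_near_cell f c e : compact (near_cell f c e).
Proof. by apply: (subclosed_compact _ cptX) => //; exact: closed_near_cell. Qed.

Lemma near_cell_cover f (e : R) : 0 < e -> exists N (c : 'I_N -> 'rV[R]_n),
  [set: X] = \big[setU/set0]_i near_cell f (c i) e.
Proof.
move=> e0; have [N [c cP]] := compact_ball_net e0 (@compact_range f).
exists N, c; apply/seteqP; split => // x _.
have [|i [_ fx]] := cP (f x); first by exists x.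
rewrite (bigD1 i)//; left => l; rewrite distrC ltW//; exact: fx.
Qed.

Lemma nowhere_dense_cdim k : (k < n)%N -> ~ cdim_le [set: X] k ->
  nowhere_dense [set f : Cn cptX n | cdim_le (range f) k].
Proof.
move=> kn Xk; apply/seteqP; split => // f.
rewrite /interior nbhs_ballP => -[r /= r0 rA].
have sn0 : 0 < Num.sqrt n%:R + 1 :> R by rewrite ltr_wpDl// sqrtr_ge0.
(* Planting moves coordinates by at most 2 e, hence f by at most 2 r / 3 in the supremum norm. *)
pose e := r / (3 * (Num.sqrt n%:R + 1)).
have e0 : 0 < e by rewrite divr_gt0// mulr_gt0.
have [N [c cX]] := near_cell_cover f e0.
have [i Ki] : exists i, ~ cdim_le (near_cell f (c i) e) k.
  apply: contrapT => /forallNP H; apply: Xk; rewrite cX.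
  apply: cdim_le_bigU => i; first exact: closed_near_cell.
  exact: contrapT (H i).
have : ~ inessential R k.+1 (near_cell f (c i) e).
  by apply: contra_not Ki; apply: inessential_cdim_le; exact: compact_near_cell.
move=> /existsNP[g /not_implyP[cg nh]].
have cst0 (a : R) : continuous (fun _ : X => a) by exact: cst_continuous.
(* The first k+1 coordinates carry g, clamped to [-1, 1]; the faces g >= 1 and g <= -1 are
   unaffected. *)
pose u (l : 'I_n) x := if insub (l : nat) is Some j
  then Num.max (-1) (Num.min 1 (g j x)) else 0.
have cu l : continuous (u l).
  rewrite /u; case: (insub _) => [j|]; last exact: cst0.
  by apply: continuous_maxr => //; apply: continuous_minr => //; exact: cg.
have u1 l x : `|u l x| <= 1.
  rewrite /u; case: (insub _) => [j|]; last by rewrite normr0.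
  by rewrite ler_norml le_max lexx ge_max ge_min lexx/= andbT; lra.
have [F [fF FE]] := Cn_plant f (c i) e0 cu u1.
have fFr : ball f r F.
  apply: (Cn_ball _ _ fF); first by rewrite mulr_ge0// ltW.
  rewrite /e mulrA [_ * (r / _)]mulrA ltr_pdivrMr ?mulr_gt0//.
  by rewrite mulrC ltr_pM2l// mulrC ltr_pM2r//; lra.
have e20 : 0 < e / 2 by rewrite divr_gt0.
(* F lies in the closure, so some map h with image of dimension at most k is within e / 2 of it. *)
have [h [/= hk Fh]] := rA _ fFr _ (nbhsx_ballx _ _ e20).
have w (j : 'I_k.+1) : (j < n)%N by rewrite (leq_trans (ltn_ord j)).
have := @cdim_le_inessential R _ _ _ (@compact_range h) hk.
pose wj j := Ordinal (w j).
(* On the faces F differs from c by e, so h differs by more than e / 2; the factor 2 / e brings this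
   back above 1. *)
move=> /(_ (fun j y => (y ord0 (wj j) - c i ord0 (wj j)) * (2 / e))) [].
  move=> j; apply: continuous_mulr; last exact: cst_continuous.
  apply: continuous_subr; last exact: cst_continuous.
  exact: coord_continuous.
move=> h' [ch' hpos hneg h0]; apply: nh.
have Fhx x j : near_cell f (c i) e x ->
    `|c i ord0 (wj j) + e * Num.max (-1) (Num.min 1 (g j x)) - h x ord0 (wj j)| < e / 2.
  move=> Kx; have := Cn_coord_dist Fh x (wj j); rewrite FE//.
  by rewrite /u (_ : insub _ = Some j)// (valK j).
have e2 : 0 < 2 / e by rewrite divr_gt0.
exists (fun j x => h' j (h x)); split.
- by move=> j; exact: continuous_compose (@CnP h) (ch' j).
- move=> j x Kx gx; apply: hpos; first by exists x.
  have := Fhx x j Kx; rewrite min_l// max_r; last lra.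
  rewrite mulr1 ltr_norml => /andP[_ ?].
  by rewrite mulrA ler_pdivlMr//; lra.
- move=> j x Kx gx; apply: hneg; first by exists x.
  have := Fhx x j Kx; rewrite min_r; last lra.
  rewrite max_l// mulrN1 ltr_norml => /andP[? _].
  by rewrite mulrA ler_pdivrMr//; lra.
- by move=> x _; apply: h0; exists x.
Qed.

Lemma dense_ge_n (O : set (Cn cptX n)) : ~ countable [set: X] -> open O ->
  O !=set0 -> exists2 F, O F & ~ inessential R n (range F).
Proof.
move=> nX oO [f Of]; have := oO f Of; rewrite /interior nbhs_ballP => -[r /= r0 rO].
have sn0 : 0 < Num.sqrt n%:R + 1 :> R by rewrite ltr_wpDl// sqrtr_ge0.
pose e := r / (3 * (Num.sqrt n%:R + 1)).
have e0 : 0 < e by rewrite divr_gt0// mulr_gt0.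
have [N [c cX]] := near_cell_cover f e0.
have [i Ki] : exists i, ~ countable (near_cell f (c i) e).
  apply: contrapT => /forallNP H; apply: nX; rewrite cX.
  elim/big_ind: _ => [|A B|i _]; first exact: countable0.
    exact: countable_setU.
  exact: contrapT (H i).
have [v [cv v01 vK]] := cube_image n (@compact_near_cell f (c i) e) Ki.
have [|l x|F [fF FE]] := Cn_plant f (c i) e0 (u := fun l x => 2 * v l x - 1).
- move=> l; apply: continuous_subr; last exact: cst_continuous.
  by apply: continuous_mulr => //; exact: cst_continuous.
- by have /andP[? ?] := v01 l x; rewrite ler_norml; apply/andP; split; lra.
exists F.
  apply: rO; apply: (Cn_ball _ _ fF); first by rewrite mulr_ge0// ltW.
  rewrite /e mulrA [_ * (r / _)]mulrA ltr_pdivrMr ?mulr_gt0//.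
  by rewrite mulrC ltr_pM2l// mulrC ltr_pM2r//; lra.
apply: (@cube_essential _ _ _ (c i) e) => // y y1.
have [|x Kx vy] := vK (fun l => (y ord0 l + 1) / 2).
  move=> l; have := y1 l; rewrite ler_norml => /andP[? ?].
  by apply/andP; split; lra.
exists x => //; apply/rowP => l; rewrite FE// vy !mxE; congr (_ + _ * _).
by field.
Qed.

End Cn_perturbation.

Lemma sum_support (V : nmodType) N k (J : {set 'I_N}) (i0 : 'I_N)
    (F : 'I_N -> V) : (forall i, i \notin J -> F i = 0) -> (#|J| <= k)%N ->
  \sum_i F i =
  \sum_(l < k) (if (l < #|J|)%N then F (nth i0 (enum J) l) else 0).
Proof.
move=> FJ Jk; rewrite -big_mkcond /=.
rewrite -(big_ord_widen _ (fun l => F (nth i0 (enum J) l)) Jk).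
rewrite (bigID (mem J))/= [X in _ + X]big1// addr0 -big_enum /=.
by rewrite (big_nth i0) big_mkord cardE.
Qed.

(** The weight of one vertex is eliminated because the weights sum to 1. Missing vertices are padded
    with weight 0, so that the vertex lists a range over a finite type independent of the point. *)
Lemma convex_comb_affine (R : realType) n N k (c : 'I_N -> 'rV[R]_n)
    (lam : 'I_N -> R) : (forall i, 0 <= lam i) -> \sum_i lam i = 1 ->
  (#|[set i | lam i != 0%R]%SET| <= k.+1)%N ->
  exists (a : {ffun 'I_k.+1 -> 'I_N}) (mu : 'I_k -> R),
    (forall l, 0 <= mu l <= 1) /\
    \sum_i lam i *: c i =
    c (a ord0) + \sum_l mu l *: (c (a (lift ord0 l)) - c (a ord0)).
Proof.
move=> lam0 lam1; set J := [set i | _]%SET => Jk.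
have lamle i : lam i <= 1.
  by rewrite -lam1 (bigD1 i)//= lerDl sumr_ge0.
have [i0 _] : exists i0 : 'I_N, true.
  apply: contrapT => /forallNP H; have := oner_neq0 R.
  by rewrite -lam1 big1 ?eqxx// => i; case: (H i).
pose m l := if (l < #|J|)%N then lam (nth i0 (enum J) l) else 0.
have lamJ i : i \notin J -> lam i = 0 by rewrite inE negbK => /eqP.
have sumc : \sum_i lam i *: c i = \sum_(l < k.+1) m l *: c (nth i0 (enum J) l).
  rewrite (sum_support i0 _ Jk) => [|i /lamJ ->]; last by rewrite scale0r.
  by apply: eq_bigr => l _; rewrite /m; case: ifP => // _; rewrite scale0r.
have sum1 : \sum_(l < k.+1) m l = 1 by rewrite -lam1 (sum_support i0 lamJ Jk).
exists [ffun l : 'I_k.+1 => nth i0 (enum J) l], (fun l => m (lift ord0 l)); split.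
  by move=> l; rewrite /m; case: ifP => _; rewrite ?lam0 ?lamle// lexx ler01.
rewrite sumc big_ord_recl; under [in RHS]eq_bigr do rewrite !ffunE scalerBr.
rewrite ffunE sumrB -scaler_suml addrCA addrC; congr (_ + _).
have -> : \sum_(l < k) m (lift ord0 l) = 1 - m (@ord0 k).
  by rewrite -sum1 big_ord_recl addrC addrA addNr add0r.
by rewrite scalerBl scale1r opprB addrCA subrr addr0.
Qed.

(** * Density of maps with economically covered images *)

Section low_dimensional_image.
Context {R : realType} (X : metricType R) (cptX : compact [set: X]) (n : nat).
Implicit Types (f g : Cn cptX n).

(* The nerve of a fine cover of order k.+1 gives a map close to f into finitely
   many k-simplices. *)
Lemma Cn_poly_approx f (e : R) k : 0 < e -> cdim_le [set: X] k ->
  exists N (c : 'I_N -> 'rV[R]_n) (F : Cn cptX n),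
    (forall x i, `|f x ord0 i - F x ord0 i| <= e) /\
    forall x, exists (a : {ffun 'I_k.+1 -> 'I_N}) (mu : 'I_k -> R),
      (forall l, 0 <= mu l <= 1) /\
      F x = c (a ord0) + \sum_l mu l *: (c (a (lift ord0 l)) - c (a ord0)).
Proof.
move=> e0 Xk; have [N [c cP]] := compact_ball_net e0 (@compact_range _ _ _ _ f).
have oU i : open (f @^-1` ball (c i) e).
  by apply: open_comp => [x _|]; [exact: CnP|exact: ball_open].
have [|V [oV VU XV Vk]] := Xk _ (fun i => f @^-1` ball (c i) e) oU.
  by move=> x _; apply: cP; exists x.
pose p i := bump (V i).
have cp i : continuous (p i) by exact: bump_continuous.
pose P x := \sum_i p i x.
have cP' : continuous P by exact: continuous_sumr.
have P0 x : 0 < P x.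
  have [//|i Vx] := XV x; rewrite /P (bigD1 i)//= ltr_wpDr ?bump_gt0//.
  by apply: sumr_ge0 => j _; exact: bump_ge0.
pose lam x i := p i x / P x.
have lam0 x i : 0 <= lam x i by rewrite divr_ge0 ?bump_ge0// ltW.
have lam1 x : \sum_i lam x i = 1 by rewrite /lam -mulr_suml divff// (gt_eqF (P0 x)).
have [l|F FE] := @Cn_of_coords _ _ cptX _ (fun l x => \sum_i lam x i * c i ord0 l).
  apply: continuous_sumr => i; apply: continuous_mulr; last exact: cst_continuous.
  apply: continuous_mulr => // x; apply: cvgV; first by rewrite gt_eqF.
  exact: cP'.
exists N, c, F; split=> [x l|x].
  (* Both sides are averaged with the same weights; a nonzero weight means that x lies in [V i],
     where f is within e of [c i]. *)
  rewrite FE -[f x ord0 l]mul1r -(lam1 x) mulr_suml -sumrB.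
  apply: le_trans (ler_norm_sum _ _ _) _.
  rewrite -[leRHS]mul1r -(lam1 x) mulr_suml; apply: ler_sum => i _.
  rewrite -mulrBr normrM ger0_norm//.
  have [pi0|] := eqVneq (p i x) 0; first by rewrite /lam pi0 !mul0r.
  move=> pi0; rewrite ler_wpM2l// ltW//.
  have /VU[_] : V i x by apply: bump_gt0_in; rewrite lt0r pi0 bump_ge0.
  by move=> /(_ ord0 l); rewrite /ball /= distrC.
have [|a [mu [mu01 E]]] := convex_comb_affine c (lam0 x) (lam1 x) (k := k).
  apply: (Vk x) => // j; rewrite inE /lam mulf_eq0 negb_or => /andP[pj _].
  by apply: bump_gt0_in; rewrite lt0r pj bump_ge0.
exists a, mu; split => //; rewrite -E; apply/rowP => l.
by rewrite FE summxE; apply: eq_bigr => i _; rewrite mxE.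
Qed.

(** A single j controls both the range of scales and the slack in the exponent, so that countably
    many sets suffice. *)
Definition uncovered (k j : nat) : set (Cn cptX n) :=
  [set f | forall d N, 0 < d < j.+1%:R^-1 -> Defs.covered_by (range f) d N ->
     d `^ (- (k%:R + j.+1%:R^-1)) < N%:R].

Lemma nowhere_dense_uncovered k j : cdim_le [set: X] k ->
  nowhere_dense (uncovered k j).
Proof.
move=> Xk; apply/seteqP; split => // f.
rewrite /interior nbhs_ballP => -[r /= r0 rA].
have sn0 : 0 < Num.sqrt n%:R + 1 :> R by rewrite ltr_wpDl// sqrtr_ge0.
pose e := r / (2 * (Num.sqrt n%:R + 1)).
have e0 : 0 < e by rewrite divr_gt0// mulr_gt0.
have [N [c [F [fF FE]]]] := Cn_poly_approx f e0 Xk.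
have fFr : ball f r F.
  apply: (Cn_ball _ _ fF); first exact: ltW.
  rewrite /e mulrA ltr_pdivrMr ?mulr_gt0//.
  by rewrite mulrC ltr_pM2l//; lra.
have j0 : 0 < j.+1%:R^-1 :> R by rewrite invr_gt0.
have [|d [M [d0 FM Md]]] := @affine_image_covers _ _ (range F) k _
    (fun a : {ffun 'I_k.+1 -> 'I_N} => c (a ord0))
    (fun a l => c (a (lift ord0 l)) - c (a ord0)) _ _ _ j0 j0.
  by move=> _ [x _ <-]; exact: FE.
have [U [UP FU]] := FM.
pose O := \bigcup_i U i.
have oO : open O by apply: bigcup_open => i _; have [] := UP i.
(* The compact image of F keeps a distance b from leaving the open cover, so the same sets cover the
   image of every map within b / 2. *)
have [||b b0 Ob] := @compact_gt0_bounded _ _ _ (bump O) (@compact_range _ _ _ _ F).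
- exact: bump_continuous.
- by move=> y /FU Oy; exact: bump_gt0.
have b20 : 0 < b / 2 by rewrite divr_gt0.
have [h [/= hk Fh]] := rA _ fFr _ (nbhsx_ballx _ _ b20).
have : Defs.covered_by (range h) d M.
  exists U; split => // _ [x _ <-].
  have : ball (F x) (b / 2) `<=` O.
    apply: lt_bump_ball; first exact: ltW.
    by apply: lt_le_trans (Ob (F x) _); [lra|exists x].
  by apply; apply: ball_rV => // i; exact: Cn_coord_dist Fh x i.
by move=> /(hk _ _ d0); rewrite ltNge Md.
Qed.

Lemma lower_dimB_uncovered k f (x0 : X) :
  (k%:R%:E < lower_dimB (range f))%E -> exists j, uncovered k j f.
Proof.
move=> kf; apply: contrapT => /forallNP H; move: kf; apply/negP; rewrite -leNgt.
apply: lower_dimB_le => [|eta d0 eta0 d00]; first by exists (f x0), x0.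
(* Taking 1 / (j+1) below eta and d0 serves exponent and scale at once; below 1, a larger slack only
   enlarges the allowed number of sets. *)
pose m := Num.min eta (Num.min d0 1).
have m0 : 0 < m by rewrite !lt_min eta0 d00 ltr01.
pose j := Num.truncn m^-1.
have jm : j.+1%:R^-1 < m.
  by rewrite -[ltRHS]invrK ltf_pV2 ?posrE ?invr_gt0// truncnS_gt.
move: jm; rewrite !lt_min => /and3P[jeta jd j1].
have /existsNP[d /existsNP[N /not_implyP[d01 /not_implyP[fN /negP]]]] := H j.
rewrite -leNgt => Nd; move: d01 => /andP[dp dj].
exists d, N; split => //; first by rewrite dp (lt_trans dj).
apply: le_trans Nd _; apply: ger_powR; first by rewrite dp (le_trans (ltW dj))// ltW.
by rewrite lerN2 lerD2l ltW.
Qed.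

End low_dimensional_image.

(** * The three dimensions of an image, and the decomposition of the space of maps *)

Section dimensions_of_images.
Context {R : realType} (X : metricType R) (cptX : compact [set: X]) (n : nat).
Variable x0 : X.
Implicit Types (f g : Cn cptX n).
Local Open Scope ereal_scope.

Lemma range_neq0 f : range f !=set0. Proof. by exists (f x0), x0. Qed.

Lemma dimension_chain f (dim : set 'rV[R]_n -> \bar R) :
  [\/ dim = dimT, dim = dimH | dim = lower_dimB] ->
  [/\ 0 <= dimT (range f), dimT (range f) <= dim (range f),
      dim (range f) <= lower_dimB (range f) &
      lower_dimB (range f) <= n%:R%:E].
Proof.
move=> dimE; have cf := @compact_range _ _ _ _ f.
have TH := dimT_le_dimH cf; have HB := dimH_le_lower_dimB (range_neq0 f).
split; first exact: topological_dim_ge0.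
- by case: dimE => -> //; exact: le_trans TH HB.
- by case: dimE => -> //; exact: le_trans TH HB.
- by apply: lower_dimB_le_n; [exact: range_neq0|exact: compact_bounded].
Qed.

End dimensions_of_images.

Local Open Scope ereal_scope.

Theorem theorem2p2 (R : realType) (X : metricType R)
    (cptX : compact [set: X]) (uncountableX : ~ countable [set: X])
    (n : nat) (n_gt0 : (0 < n)%N)
    (dim : set 'rV[R]_n -> \bar R)
    (dimE : [\/ dim = dimT, dim = dimH | dim = lower_dimB]) :
  let dimX : \bar R := topological_dim X in
  let m : \bar R := Order.min n%:R%:E dimX in
  let A := [set f : Cn cptX n | 0 <= dim (range f) /\ dim (range f) < m] in
  let B := [set f : Cn cptX n | dim (range f) = m] in
  let C := [set f : Cn cptX n | m < dim (range f) /\ dim (range f) <= n%:R%:E] in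
  [/\ A `|` B `|` C = [set: Cn cptX n],
      [/\ A `&` B = set0, A `&` C = set0 & B `&` C = set0],
      nowhere_dense A,
      residual B &
      (n%:R%:E <= dimX -> C = set0) /\
      (~ (n%:R%:E <= dimX) -> meagre C /\ dense C)].
Proof.
move=> dimX m A B C.
have [x0 _] : [set: X] !=set0.
  by apply/set0P/eqP => X0; apply: uncountableX; rewrite X0; exact: countable0.
have chain (f : Cn cptX n) := dimension_chain x0 f dimE.
have dim_ge0 (f : Cn cptX n) : 0 <= dim (range f).
  by have [T0 Td _ _] := chain f; exact: le_trans Td.
have dim_len (f : Cn cptX n) : dim (range f) <= n%:R%:E.
  by have [_ _ dB Bn] := chain f; exact: le_trans Bn.
have ABC : A `|` B `|` C = [set: Cn cptX n].
  apply/seteqP; split => // f _; have [fm|mf|fm] := ltgtP (dim (range f)) m.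
  - by left; left.
  - by right.
  - by left; right.
have AB0 : A `&` B = set0.
  by apply/seteqP; split => // f [[_ fm] fB]; rewrite fB ltxx in fm.
have AC0 : A `&` C = set0.
  apply/seteqP; split => // f [[_ fm] [mf _]].
  by have := lt_trans fm mf; rewrite ltxx.
have BC0 : B `&` C = set0.
  by apply/seteqP; split => // f [fB [mf _]]; rewrite fB ltxx in mf.
have C0 : n%:R%:E <= dimX -> C = set0.
  move=> nX; apply/seteqP; split => // f [mf fn].
  by move: mf; rewrite /m min_l// ltNge fn.
(* The minimum m is a natural number even if X has infinite dimension. *)
have [p [mp pn Xp]] : exists p, [/\ m = p%:R%:E, (p <= n)%N &
    forall k, (k < p)%N -> ~ cdim_le [set: X] k].
  have low p : p%:R%:E <= dimX -> forall k, (k < p)%N -> ~ cdim_le [set: X] k.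
    move=> pX k kp /covering_dim_leT/(@topological_dim_le R)/(le_trans pX).
    by rewrite lee_fin ler_nat leqNgt kp.
  have [nX|Xn] := leP n%:R%:E dimX.
    by exists n; split => //; [rewrite /m min_l|exact: low].
  have [j _ dj] := topological_dim_nat Xn.
  exists j; split; first by rewrite /m min_r// ltW.
    by rewrite -(ler_nat R) -lee_fin -dj ltW.
  by apply: low; rewrite -dj.
have ndA : nowhere_dense A.
  (* For p = 0 the set A is empty; otherwise its maps have images of covering dimension at most k =
     p - 1, which X exceeds. *)
  case: p mp pn Xp => [|k] mp pn Xp.
    apply: nowhere_dense_sub (@nowhere_dense0 _) => f [f0].
    by rewrite mp ltNge f0.
  apply: nowhere_dense_sub (nowhere_dense_cdim cptX pn (Xp k (ltnSn k))).
  move=> f [_ fm] /=; have [_ Td _ _] := chain f.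
  have /topological_dim_lt[j jk] : dimT (range f) < k.+1%:R%:E.
    by rewrite -mp; exact: le_lt_trans Td fm.
  by move=> /covering_dim_le_set_type; exact: cdim_leW.
have Xk : ~ (n%:R%:E <= dimX) -> exists2 k, cdim_le [set: X] k & m = k%:R%:E.
  move=> /negP; rewrite -ltNge => Xn; have [j Xj dj] := topological_dim_nat Xn.
  by exists j; [exact/covering_dim_leT|rewrite /m min_r ?ltW].
have CF k : m = k%:R%:E -> C `<=` \bigcup_j @uncovered R X cptX n k j.
  move=> mk f [mf _]; have [_ _ dB _] := chain f.
  have [|j fj] := @lower_dimB_uncovered _ _ cptX n k f x0; last by exists j.
  by rewrite -mk; exact: lt_le_trans dB.
have nB : ~` B = A `|` C.
  apply/seteqP; split => f.
    by have : [set: Cn cptX n] f by []; rewrite -ABC => -[[]|] //; [left|right].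
  case=> [Af|Cf] Bf.
    by suff : set0 f by []; rewrite -AB0.
  by suff : set0 f by []; rewrite -BC0.
split => //.
  rewrite /residual nB; have [nX|/Xk[k Xk' mk]] := pselect (n%:R%:E <= dimX).
    apply: (@meagre_sub _ _ A (fun=> set0)) => //.
      by move=> _; exact: nowhere_dense0.
    by rewrite C0// setU0 => f Af; left.
  apply: (@meagre_sub _ _ A (@uncovered R X cptX n k)) => //.
    by move=> j; exact: nowhere_dense_uncovered.
  by apply: setUS; exact: CF.
split => // /[dup] nX /Xk[k Xk' mk]; split.
  apply: (@meagre_sub _ _ set0 (@uncovered R X cptX n k)); first exact: nowhere_dense0.
    by move=> j; exact: nowhere_dense_uncovered.
  by rewrite set0U; exact: CF.
(* The planted cube gives an image of topological dimension at least n, and m < n here. *)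
move=> O O0 oO; have [F OF nF] := dense_ge_n uncountableX oO O0.
exists F; split => //; split; last exact: dim_len.
have mn : m < n%:R%:E.
  by move/negP: nX; rewrite -ltNge => Xn; rewrite /m min_r ?ltW.
apply: lt_le_trans mn _; have [_ Td _ _] := chain F; apply: le_trans Td.
rewrite leNgt; apply/negP => /topological_dim_lt[j jn].
move=> /covering_dim_le_set_type Fj; apply: nF.
suff : inessential R n.-1.+1 (range F) by rewrite prednK.
apply: cdim_le_inessential; first exact: compact_range.
by apply: cdim_leW Fj; rewrite -ltnS prednK.
Qed.
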